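(* Let $\Bbbk$ be a commutative ring and let $q$ be either an indeterminate over $\Bbbk$ or an invertible element of $\Bbbk$. With the bimodule maps $\mathrm{RCap}$, $\mathrm{RCup}$, $\mathrm{LCap}$, $\mathrm{LCup}$, $X=\mathrm{Ucross}$ between tensor products of the induction and restriction bimodules of the Hecke algebras $H_n$ ($n\ge0$), and with $R=(\mathrm{id}\otimes\mathrm{RCap})(\mathrm{id}\otimes X\otimes\mathrm{id})(\mathrm{RCup}\otimes\mathrm{id})$ and $L=(\mathrm{LCap}\otimes\mathrm{id})(\mathrm{id}\otimes X\otimes\mathrm{id})(\mathrm{id}\otimes\mathrm{LCup})$, the following equalities of bimodule maps hold for every rightmost label $n\ge0$: 1. $X^2=q\,\mathrm{id}+(q-1)X$ on $B_{++}(n)$; 2. $(X\otimes\mathrm{id})(\mathrm{id}\otimes X)(X\otimes\mathrm{id})=(\mathrm{id}\otimes X)(X\otimes\mathrm{id})(\mathrm{id}\otimes X)$ on $B_{+++}(n)$; 3. $R\circ L=q\,\mathrm{id}-q\,\mathrm{RCup}\circ\mathrm{LCap}$ on $B_{-+}(n)$, and $L\circ R=q\,\mathrm{id}$ on $B_{+-}(n)$; 4. $\mathrm{LCap}\circ\mathrm{RCup}=\mathrm{id}$ on $B_\varnothing(n)=H_n$, and $(\mathrm{LCap}\otimes\mathrm{id})(\mathrm{id}\otimes X)(\mathrm{RCup}\otimes\mathrm{id})=0$ on $B_+(n)$.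
   Context: $H_n$ is the $\Bbbk[q,q^{-1}]$-algebra generated by $t_1,\dots,t_{n-1}$ with relations $t_i^2=q+(q-1)t_i$, $t_it_j=t_jt_i$ for $|i-j|>1$, $t_it_{i+1}t_i=t_{i+1}t_it_{i+1}$; $H_0=H_1=\Bbbk[q,q^{-1}]$ (if $q\in\Bbbk^\times$ then $\Bbbk[q,q^{-1}]=\Bbbk$). For $k\le n$, $H_k\subseteq H_n$ via $t_i\mapsto t_i$. Write $_k(n)_l$ for $H_n$ as an $(H_k,H_l)$-bimodule, omitting subscripts equal to $n$; juxtaposition denotes tensor product over the common middle algebra, e.g. $(n)_{n-1}(n)=H_n\otimes_{H_{n-1}}H_n$. Standard isomorphisms such as $(n+2)_{n+1}(n+1)_n\cong(n+2)_n$ and $_n(n+1)\otimes_{H_{n+1}}(n+1)_n\cong{}_n(n+1)_n$ are used implicitly. For a sign sequence $\varepsilon$ and an integer $n\ge0$ (the label of the rightmost region), let $B_\varepsilon(n)$ be the tensor product of bimodules obtained by reading $\varepsilon$ from right to left, starting with label $n$: a sign $+$ raises the label from $j$ to $j+1$ and contributes $(j+1)_j$; a sign $-$ lowers the label from $j$ to $j-1$ and contributes $_{j-1}(j)$. If a label becomes negative, $B_\varepsilon(n)=0$. $B_\varnothing(n)=(n)=H_n$. Thus $B_{+-}(n)=(n)_{n-1}(n)$, $B_{-+}(n)={}_n(n+1)_n$, $B_{++}(n)=(n+2)_n$. The basic bimodule maps (each one defined for every rightmost label): - $\mathrm{RCap}:B_{+-}(n)=(n)_{n-1}(n)\to(n)$,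 $x\otimes y\mapsto xy$; - $\mathrm{RCup}:(n)\to{}_n(n+1)_n=B_{-+}(n)$, $z\mapsto z$; - $\mathrm{LCap}:{}_n(n+1)_n\to(n)$, the $(H_n,H_n)$-bimodule map with $\mathrm{LCap}|_{H_n}=\mathrm{id}$ and $\mathrm{LCap}(t_n)=0$; - $\mathrm{LCup}:(n)\to(n)_{n-1}(n)$, the bimodule map with $1_n\mapsto\sum_{i=1}^{n}q^{i-n}\,t_i\cdots t_{n-1}\otimes t_{n-1}\cdots t_i$ (the $i=n$ term is $1\otimes1$); - $X=\mathrm{Ucross}:(n+2)_n\to(n+2)_n$, $z\mapsto zt_{n+1}$. In the claim, each factor in a composite is the map with the label determined by its position, and $\mathrm{id}$ is the identity of the remaining tensor factors. Explicitly, $R:B_{+-}(n)\to B_{-++-}(n)\to B_{-++-}(n)\to B_{-+}(n)$ and $L:B_{-+}(n)\to B_{-++-}(n)\to B_{-++-}(n)\to B_{+-}(n)$, where in both cases $X$ acts on the middle $++$. *)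

(* Defs.v *)
From HB Require Import structures.
From mathcomp Require Import all_boot all_order all_algebra.
From mathcomp Require Import generic_quotient boolp.
From mathcomp Require Import zify.

Set Implicit Arguments.
Unset Strict Implicit.
Unset Printing Implicit Defensive.

Import GRing.Theory.
Local Open Scope ring_scope.

Section PropQuotient.
Variables (T : Type) (R : T -> T -> Prop).
Hypotheses (Rrefl : forall x, R x x) (Rsym : forall x y, R x y -> R y x)
  (Rtrans : forall x y z, R x y -> R y z -> R x z).

Let e : rel {classic T} := fun x y => `[< R x y >].

Fact pquot_refl : reflexive e. Proof. by move=> x; apply/asboolP. Qed.
Fact pquot_sym : symmetric e.
Proof. by move=> x y; apply/asboolP/asboolP; apply: Rsym. Qed.
Fact pquot_trans : transitive e.
Proof. by move=> y x z /asboolP xy /asboolP yz; apply/asboolP/(Rtrans xy). Qed.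

Definition pquot_rel := EquivRel e pquot_refl pquot_sym pquot_trans.
Definition pquot := {eq_quot pquot_rel}%qT.
Definition pquot_pi (x : T) : pquot := (\pi_pquot (x : {classic T}))%qT.
Definition pquot_repr (u : pquot) : T := repr u.

Lemma pquot_reprK u : pquot_pi (pquot_repr u) = u. Proof. exact: reprK. Qed.

Lemma pquot_eqP x y : pquot_pi x = pquot_pi y <-> R x y.
Proof.
split=> [/eqquotP /asboolP //|Rxy]; by apply/eqquotP/asboolP.
Qed.

Lemma pquot_repr_pi x : R (pquot_repr (pquot_pi x)) x.
Proof. by apply/pquot_eqP; rewrite pquot_reprK. Qed.

End PropQuotient.

(* For q invertible with inverse qV: [f : k -> A] makes A the ring k[q,q^-1] of
   Laurent polynomials in the indeterminate q. *)
Definition is_laurent (k A : comPzRingType) (f : {rmorphism k -> A})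
    (q qV : A) : Prop :=
  (forall a : A, exists (N d : nat) (c : nat -> k),
     a = qV ^+ N * \sum_(i < d) f (c i) * q ^+ i) /\
  (forall (d : nat) (c : nat -> k),
     \sum_(i < d) f (c i) * q ^+ i = 0 -> forall i, (i < d)%N -> c i = 0).

Section Hecke.
Variables (A : comPzRingType) (q : A).

Definition hidx (n : nat) := {i : nat | (0 < i < n)%N}.

(* noncommutative polynomial expressions in t_1, ..., t_(n-1) over A *)
Inductive hterm (n : nat) : Type :=
| HCst of A
| HGen of hidx n
| HAdd of hterm n & hterm n
| HMul of hterm n & hterm n.
Arguments HCst {n} _.

(* the congruence generated by the axioms of A-algebras and the relations of
   the Hecke algebra *)
Inductive heq (n : nat) : hterm n -> hterm n -> Prop :=
| heq_refl x : heq x x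
| heq_sym x y : heq x y -> heq y x
| heq_trans x y z : heq x y -> heq y z -> heq x z
| heq_add x x' y y' : heq x x' -> heq y y' -> heq (HAdd x y) (HAdd x' y')
| heq_mul x x' y y' : heq x x' -> heq y y' -> heq (HMul x y) (HMul x' y')
| heq_addA x y z : heq (HAdd x (HAdd y z)) (HAdd (HAdd x y) z)
| heq_addC x y : heq (HAdd x y) (HAdd y x)
| heq_add0 x : heq (HAdd (HCst 0) x) x
| heq_mulA x y z : heq (HMul x (HMul y z)) (HMul (HMul x y) z)
| heq_mul1 x : heq (HMul (HCst 1) x) x
| heq_mul0 x : heq (HMul (HCst 0) x) (HCst 0)
| heq_mulDl x y z : heq (HMul (HAdd x y) z) (HAdd (HMul x z) (HMul y z))
| heq_mulDr x y z : heq (HMul x (HAdd y z)) (HAdd (HMul x y) (HMul x z))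
| heq_cstD a b : heq (HCst (a + b)) (HAdd (HCst a) (HCst b))
| heq_cstM a b : heq (HCst (a * b)) (HMul (HCst a) (HCst b))
| heq_cstC a x : heq (HMul (HCst a) x) (HMul x (HCst a))
| heq_quad i :
    heq (HMul (HGen i) (HGen i)) (HAdd (HCst q) (HMul (HCst (q - 1)) (HGen i)))
| heq_far i j : (val i + 1 < val j)%N ->
    heq (HMul (HGen i) (HGen j)) (HMul (HGen j) (HGen i))
| heq_braid i j : val j = (val i).+1 ->
    heq (HMul (HGen i) (HMul (HGen j) (HGen i)))
        (HMul (HGen j) (HMul (HGen i) (HGen j))).

Definition hecke (n : nat) : Type :=
  pquot (@heq_refl n) (@heq_sym n) (@heq_trans n).

HB.instance Definition _ n := Choice.on (hecke n).

Section HeckeRing.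
Variable n : nat.
Implicit Types (x y z : hecke n) (a b : A).

Definition hcl (u : hterm n) : hecke n := pquot_pi _ _ _ u.
Definition hrep x : hterm n := pquot_repr x.

Lemma hrepK x : hcl (hrep x) = x. Proof. exact: pquot_reprK. Qed.
Lemma hclP u v : hcl u = hcl v <-> heq u v. Proof. exact: pquot_eqP. Qed.
Lemma hrep_cl u : heq (hrep (hcl u)) u. Proof. exact: pquot_repr_pi. Qed.

Definition hcst a : hecke n := hcl (HCst a).
Definition hadd x y := hcl (HAdd (hrep x) (hrep y)).
Definition hmul x y := hcl (HMul (hrep x) (hrep y)).
Definition hopp x := hmul (hcst (-1)) x.

Lemma hadd_cl u v : hadd (hcl u) (hcl v) = hcl (HAdd u v).
Proof. by apply/hclP; apply: heq_add; apply: hrep_cl. Qed.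
Lemma hmul_cl u v : hmul (hcl u) (hcl v) = hcl (HMul u v).
Proof. by apply/hclP; apply: heq_mul; apply: hrep_cl. Qed.

Lemma hcl_ind (P : hecke n -> Prop) : (forall u, P (hcl u)) -> forall x, P x.
Proof. by move=> Pcl x; rewrite -(hrepK x). Qed.

Local Ltac hc := do ![elim/hcl_ind => ?]; rewrite /hopp /hcst;
  rewrite ?(hadd_cl, hmul_cl); apply/hclP.

Fact haddA : associative hadd. Proof. hc; exact: heq_addA. Qed.
Fact haddC : commutative hadd. Proof. hc; exact: heq_addC. Qed.
Fact hadd0 : left_id (hcst 0) hadd. Proof. hc; exact: heq_add0. Qed.
Fact hmulA : associative hmul. Proof. hc; exact: heq_mulA. Qed.
Fact hmul1 : left_id (hcst 1) hmul. Proof. hc; exact: heq_mul1. Qed.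
Fact hmulDl : left_distributive hmul hadd. Proof. hc; exact: heq_mulDl. Qed.
Fact hmulDr : right_distributive hmul hadd. Proof. hc; exact: heq_mulDr. Qed.
Fact hcstC a x : hmul (hcst a) x = hmul x (hcst a).
Proof. move: x; hc; exact: heq_cstC. Qed.
Fact hmulr1 : right_id (hcst 1) hmul.
Proof. by move=> x; rewrite -hcstC hmul1. Qed.
Fact hcstD a b : hcst (a + b) = hadd (hcst a) (hcst b).
Proof. by rewrite /hcst hadd_cl; apply/hclP/heq_cstD. Qed.
Fact hcstM a b : hcst (a * b) = hmul (hcst a) (hcst b).
Proof. by rewrite /hcst hmul_cl; apply/hclP/heq_cstM. Qed.
Fact haddN : left_inverse (hcst 0) hopp hadd.
Proof.
move=> x; rewrite /hopp -{2}[x]hmul1 -hmulDl -hcstD addNr.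
by move: x; hc; exact: heq_mul0.
Qed.

HB.instance Definition _ :=
  GRing.isZmodule.Build (hecke n) haddA haddC hadd0 haddN.
HB.instance Definition _ :=
  GRing.Zmodule_isPzRing.Build (hecke n) hmulA hmul1 hmulr1 hmulDl hmulDr.

Fact hcst_is_additive : zmod_morphism hcst.
Proof.
move=> a b; apply/(addIr (hcst b)); rewrite subrK.
by rewrite -[_ + _]hcstD subrK.
Qed.
Fact hcst_is_multiplicative : monoid_morphism hcst.
Proof. by split=> // a b; apply: hcstM. Qed.
HB.instance Definition _ :=
  GRing.isZmodMorphism.Build A (hecke n) hcst hcst_is_additive.
HB.instance Definition _ :=
  GRing.isMonoidMorphism.Build A (hecke n) hcst hcst_is_multiplicative.

Definition hgen (i : hidx n) : hecke n := hcl (HGen i).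

(* t_i for 0 < i < n; the value outside this range is a dummy. *)
Definition ht (i : nat) : hecke n :=
  if (insub i : option (hidx n)) is Some j then hgen j else 0.

Lemma ht_gen (j : hidx n) : ht (val j) = hgen j.
Proof. by rewrite /ht valK. Qed.

Lemma hcst_comm a x : hcst a * x = x * hcst a. Proof. exact: hcstC. Qed.

Lemma hcl_add u v : hcl (HAdd u v) = hcl u + hcl v.
Proof. by rewrite -hadd_cl. Qed.
Lemma hcl_mul u v : hcl (HMul u v) = hcl u * hcl v.
Proof. by rewrite -hmul_cl. Qed.

Lemma ht_quad i : (0 < i < n)%N -> ht i * ht i = hcst q + hcst (q - 1) * ht i.
Proof.
move=> hi; rewrite -[i]/(val (Sub i hi : hidx n)) ht_gen /hgen /hcst.
by rewrite -!(hcl_mul, hcl_add); apply/hclP/heq_quad.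
Qed.

Lemma ht_far i j : (0 < i < n)%N -> (0 < j < n)%N -> (i + 1 < j)%N ->
  ht i * ht j = ht j * ht i.
Proof.
move=> hi hj hij.
rewrite -[i]/(val (Sub i hi : hidx n)) -[j]/(val (Sub j hj : hidx n)) !ht_gen.
by rewrite /hgen -!hcl_mul; apply/hclP/heq_far.
Qed.

Lemma ht_comm i j : (0 < i < n)%N -> (0 < j < n)%N ->
  (i + 1 < j)%N || (j + 1 < i)%N -> ht i * ht j = ht j * ht i.
Proof. by move=> hi hj /orP[] h; [|symmetry]; apply: ht_far. Qed.

Lemma ht_braid i : (0 < i < n)%N -> (0 < i.+1 < n)%N ->
  ht i * (ht i.+1 * ht i) = ht i.+1 * (ht i * ht i.+1).
Proof.
move=> hi hj.
rewrite -[i.+1]/(val (Sub i.+1 hj : hidx n)).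
rewrite -[i in ht i]/(val (Sub i hi : hidx n)) !ht_gen.
by rewrite /hgen -!hcl_mul; apply/hclP/heq_braid.
Qed.

Lemma hecke_ind (P : hecke n -> Prop) :
    (forall a, P (hcst a)) -> (forall i, (0 < i < n)%N -> P (ht i)) ->
    (forall x y, P x -> P y -> P (x + y)) ->
    (forall x y, P x -> P y -> P (x * y)) ->
  forall x, P x.
Proof.
move=> Pc Pt Pa Pm; elim/hcl_ind; elim=> [a|i|u Pu v Pv|u Pu v Pv].
- exact: Pc.
- by have := Pt (val i) (valP i); rewrite ht_gen.
- by rewrite hcl_add; apply: Pa.
- by rewrite hcl_mul; apply: Pm.
Qed.

Section Lift.
Variables (T : pzRingType) (c : {rmorphism A -> T}) (g : hidx n -> T).
Hypothesis cg : forall a i, c a * g i = g i * c a.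
Hypothesis g_quad : forall i, g i * g i = c q + c (q - 1) * g i.
Hypothesis g_far : forall i j, (val i + 1 < val j)%N -> g i * g j = g j * g i.
Hypothesis g_braid : forall i j, val j = (val i).+1 ->
  g i * (g j * g i) = g j * (g i * g j).

Fixpoint heval (u : hterm n) : T :=
  match u with
  | HCst a => c a
  | HGen i => g i
  | HAdd u v => heval u + heval v
  | HMul u v => heval u * heval v
  end.

Lemma heval_heq u v : heq u v -> heval u = heval v.
Proof.
elim=> //=.
- by move=> x y z _ -> _ ->.
- by move=> x x' y y' _ -> _ ->.
- by move=> x x' y y' _ -> _ ->.
- by move=> x y z; rewrite addrA.
- by move=> x y; rewrite addrC.
- by move=> x; rewrite rmorph0 add0r.
- by move=> x y z; rewrite mulrA.
- by move=> x; rewrite rmorph1 mul1r.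
- by move=> x; rewrite rmorph0 mul0r.
- by move=> x y z; rewrite mulrDl.
- by move=> x y z; rewrite mulrDr.
- by move=> a b; rewrite rmorphD.
- by move=> a b; rewrite rmorphM.
- move=> a; elim=> [b|i|u' IHu v' IHv|u' IHu v' IHv] /=.
  + by rewrite -!rmorphM mulrC.
  + exact: cg.
  + by rewrite mulrDr mulrDl IHu IHv.
  + by rewrite mulrA IHu -mulrA IHv mulrA.
Qed.

Definition hlift (x : hecke n) : T := heval (hrep x).

Lemma hlift_cl u : hlift (hcl u) = heval u.
Proof. exact/heval_heq/hrep_cl. Qed.

Fact hlift_is_additive : zmod_morphism hlift.
Proof.
move=> x y; apply/(addIr (hlift y)); rewrite subrK.
rewrite -[in RHS](subrK y x); elim/hcl_ind: (x - y) => u.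
by elim/hcl_ind: y => v; rewrite -hcl_add !hlift_cl.
Qed.
Fact hlift_is_multiplicative : monoid_morphism hlift.
Proof.
split=> [|x y]; first by rewrite [LHS]hlift_cl /= rmorph1.
elim/hcl_ind: x => u; elim/hcl_ind: y => v.
by rewrite -hcl_mul !hlift_cl.
Qed.
HB.instance Definition _ :=
  GRing.isZmodMorphism.Build (hecke n) T hlift hlift_is_additive.
HB.instance Definition _ :=
  GRing.isMonoidMorphism.Build (hecke n) T hlift hlift_is_multiplicative.

Definition hmorph :
  {rmorphism Defs_hecke__canonical__GRing_PzSemiRing -> T} := hlift.

Lemma hmorph_cst a : hmorph (hcst a) = c a. Proof. exact: hlift_cl. Qed.
Lemma hmorph_gen i : hmorph (hgen i) = g i. Proof. exact: hlift_cl. Qed.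

End Lift.
End HeckeRing.

Section Inclusion.
Variables (k n : nat) (hkn : (k <= n)%N).

Let g (i : hidx k) : hecke n := ht n (val i).
Let g_lt (i : hidx k) : (0 < val i < n)%N.
Proof. by case/andP: (valP i) => -> /leq_trans /(_ hkn). Qed.

(* H_k is included in H_n, t_i |-> t_i *)
Definition incl : {rmorphism Defs_hecke__canonical__GRing_PzSemiRing k ->
    Defs_hecke__canonical__GRing_PzSemiRing n} :=
  @hmorph k (hecke n) (@hcst n) g
    (fun a i => @hcst_comm n a (g i)) (fun i => ht_quad (g_lt i))
    (fun i j => ht_far (g_lt i) (g_lt j))
    (fun i j ij => ltac:(by rewrite /g ij; apply: ht_braid; rewrite // -ij)).

Lemma incl_cst a : incl (hcst k a) = hcst n a. Proof. exact: hmorph_cst. Qed.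
Lemma incl_t i : (0 < i < k)%N -> incl (ht k i) = ht n i.
Proof.
move=> hi; rewrite -[i]/(val (Sub i hi : hidx k)) ht_gen.
exact: hmorph_gen.
Qed.

End Inclusion.

Lemma incl_id n (h : (n <= n)%N) x : incl h x = x.
Proof.
elim/hecke_ind: x => [a|i hi|x y|x y].
- exact: incl_cst.
- exact: incl_t.
- by rewrite rmorphD => -> ->.
- by rewrite rmorphM => -> ->.
Qed.

Lemma incl_comp k l n (hkl : (k <= l)%N) (hln : (l <= n)%N) (hkn : (k <= n)%N)
  x : incl hln (incl hkl x) = incl hkn x.
Proof.
elim/hecke_ind: x => [a|i hi|x y|x y].
- by rewrite !incl_cst.
- by rewrite !incl_t //; case/andP: hi => -> /leq_trans ->.
- by rewrite !rmorphD => -> ->.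
- by rewrite !rmorphM => -> ->.
Qed.

End Hecke.

Record bimod (R S : pzRingType) := Bimod {
  bcar :> zmodType;
  lact : R -> bcar -> bcar;
  ract : bcar -> S -> bcar;
  lactDr : forall r x y, lact r (x + y) = lact r x + lact r y;
  lactDl : forall r s x, lact (r + s) x = lact r x + lact s x;
  lactM : forall r s x, lact (r * s) x = lact r (lact s x);
  lact1 : forall x, lact 1 x = x;
  ractDl : forall x y s, ract (x + y) s = ract x s + ract y s;
  ractDr : forall x r s, ract x (r + s) = ract x r + ract x s;
  ractM : forall x r s, ract x (r * s) = ract (ract x r) s;
  ract1 : forall x, ract x 1 = x;
  lractA : forall r x s, ract (lact r x) s = lact r (ract x s)
}.

Record bimap (R S : pzRingType) (M N : bimod R S) := Bimap {
  bfun :> M -> N;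
  bmapD : forall x y, bfun (x + y) = bfun x + bfun y;
  bmapL : forall r x, bfun (lact r x) = lact r (bfun x);
  bmapR : forall x s, bfun (ract x s) = ract (bfun x) s
}.

Section BimapTheory.
Variables R S : pzRingType.
Implicit Types M N P : bimod R S.

Lemma lact0 M r : lact r (0 : M) = 0.
Proof. by apply: (addIr (lact r 0)); rewrite -lactDr !add0r. Qed.
Lemma ract0 M s : ract (0 : M) s = 0.
Proof. by apply: (addIr (ract 0 s)); rewrite -ractDl !add0r. Qed.
Lemma bmap0 M N (f : bimap M N) : f 0 = 0.
Proof. by apply: (addIr (f 0)); rewrite -bmapD !add0r. Qed.

Definition bid M : bimap M M :=
  @Bimap _ _ M M idfun (fun _ _ => erefl) (fun _ _ => erefl) (fun _ _ => erefl).

Definition bcomp M N P (f : bimap N P) (g : bimap M N) : bimap M P.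
Proof.
by exists (f \o g) => [x y|r x|x s] /=; rewrite ?(bmapD, bmapL, bmapR).
Defined.

Lemma bcompE M N P (f : bimap N P) (g : bimap M N) x : bcomp f g x = f (g x).
Proof. by []. Qed.

Definition bzero M N : bimap M N.
Proof.
by exists (fun=> 0) => [x y|r x|x s]; rewrite ?addr0 ?lact0 ?ract0.
Defined.

Definition bimod0 : bimod R S.
Proof.
by exists 'I_1 (fun _ _ => 0) (fun _ _ => 0) => * //; rewrite [RHS]ord1.
Defined.

End BimapTheory.

(* x \o y for bimodule maps *)
Notation "f \b g" := (bcomp f g) (at level 50, left associativity).

Section Tensor.
Variables (R S T : pzRingType) (M : bimod R S) (N : bimod S T).

(* The abelian group generated by the symbols x (x) y subject to
   biadditivity and xs (x) y = x (x) sy. *)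
Inductive tterm : Type :=
| TPure of M & N
| TZero
| TOpp of tterm
| TAdd of tterm & tterm.

Inductive teq : tterm -> tterm -> Prop :=
| teq_refl u : teq u u
| teq_sym u v : teq u v -> teq v u
| teq_trans u v w : teq u v -> teq v w -> teq u w
| teq_opp u u' : teq u u' -> teq (TOpp u) (TOpp u')
| teq_add u u' v v' : teq u u' -> teq v v' -> teq (TAdd u v) (TAdd u' v')
| teq_addA u v w : teq (TAdd u (TAdd v w)) (TAdd (TAdd u v) w)
| teq_addC u v : teq (TAdd u v) (TAdd v u)
| teq_add0 u : teq (TAdd TZero u) u
| teq_addN u : teq (TAdd (TOpp u) u) TZero
| teq_pureDl x x' y : teq (TPure (x + x') y) (TAdd (TPure x y) (TPure x' y))
| teq_pureDr x y y' : teq (TPure x (y + y')) (TAdd (TPure x y) (TPure x y'))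
| teq_bal x s y : teq (TPure (ract x s) y) (TPure x (lact s y)).

Definition tens_car : Type := pquot teq_refl teq_sym teq_trans.
HB.instance Definition _ := Choice.on tens_car.

Definition tcl (u : tterm) : tens_car := pquot_pi _ _ _ u.
Definition trep (x : tens_car) : tterm := pquot_repr x.
Lemma trepK x : tcl (trep x) = x. Proof. exact: pquot_reprK. Qed.
Lemma tclP u v : tcl u = tcl v <-> teq u v. Proof. exact: pquot_eqP. Qed.
Lemma trep_cl u : teq (trep (tcl u)) u. Proof. exact: pquot_repr_pi. Qed.
Lemma tcl_ind (P : tens_car -> Prop) : (forall u, P (tcl u)) -> forall x, P x.
Proof. by move=> Pcl x; rewrite -(trepK x). Qed.

Definition tadd x y := tcl (TAdd (trep x) (trep y)).
Definition topp x := tcl (TOpp (trep x)).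
Lemma tadd_cl u v : tadd (tcl u) (tcl v) = tcl (TAdd u v).
Proof. by apply/tclP; apply: teq_add; apply: trep_cl. Qed.
Lemma topp_cl u : topp (tcl u) = tcl (TOpp u).
Proof. by apply/tclP; apply: teq_opp; apply: trep_cl. Qed.

Local Ltac tc := do ![elim/tcl_ind => ?];
  rewrite ?(tadd_cl, topp_cl); apply/tclP.

Fact taddA : associative tadd. Proof. tc; exact: teq_addA. Qed.
Fact taddC : commutative tadd. Proof. tc; exact: teq_addC. Qed.
Fact tadd0 : left_id (tcl TZero) tadd. Proof. tc; exact: teq_add0. Qed.
Fact taddN : left_inverse (tcl TZero) topp tadd.
Proof. elim/tcl_ind => u; rewrite topp_cl tadd_cl; exact/tclP/teq_addN. Qed.
HB.instance Definition _ :=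
  GRing.isZmodule.Build tens_car taddA taddC tadd0 taddN.

Definition pure (x : M) (y : N) : tens_car := tcl (TPure x y).

Lemma pureDl x x' y : pure (x + x') y = pure x y + pure x' y.
Proof. by rewrite [RHS]tadd_cl; apply/tclP/teq_pureDl. Qed.
Lemma pureDr x y y' : pure x (y + y') = pure x y + pure x y'.
Proof. by rewrite [RHS]tadd_cl; apply/tclP/teq_pureDr. Qed.
Lemma pure_bal x s y : pure (ract x s) y = pure x (lact s y).
Proof. exact/tclP/teq_bal. Qed.
Lemma pure0l y : pure 0 y = 0.
Proof. by apply: (addIr (pure 0 y)); rewrite -pureDl !add0r. Qed.
Lemma pure0r x : pure x 0 = 0.
Proof. by apply: (addIr (pure x 0)); rewrite -pureDr !add0r. Qed.
Lemma pureNl x y : pure (- x) y = - pure x y.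
Proof. by apply: (addIr (pure x y)); rewrite -pureDl !addNr pure0l. Qed.

Lemma tens_ind (P : tens_car -> Prop) : P 0 -> (forall x y, P (pure x y)) ->
  (forall x y, P x -> P y -> P (x + y)) -> forall x, P x.
Proof.
move=> P0 Pp PD; suff H u : P (tcl u) /\ P (- tcl u) by elim/tcl_ind => u; case: (H u).
elim: u => [x y||u [Pu PNu]|u [Pu PNu] v [Pv PNv]].
- by rewrite -[tcl _]/(pure x y) -pureNl.
- by rewrite -[tcl _]/(0 : tens_car) oppr0.
- by rewrite -topp_cl -[topp _]/(- tcl u) opprK.
- by rewrite -tadd_cl -[tadd _ _]/(tcl u + tcl v) opprD; split; apply: PD.
Qed.

Section Lift.
Variables (G : zmodType) (f : M -> N -> G).
Hypothesis fDl : forall x x' y, f (x + x') y = f x y + f x' y.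
Hypothesis fDr : forall x y y', f x (y + y') = f x y + f x y'.
Hypothesis fbal : forall x s y, f (ract x s) y = f x (lact s y).

Fixpoint teval (u : tterm) : G :=
  match u with
  | TPure x y => f x y
  | TZero => 0
  | TOpp u => - teval u
  | TAdd u v => teval u + teval v
  end.

Lemma teval_teq u v : teq u v -> teval u = teval v.
Proof.
elim=> //= [u1 v1 w1 _ -> //|u1 v1 _ -> //|u1 v1 u2 v2 _ -> _ -> //|u1 v1 w1|u1 v1|u1|u1].
- exact: addrA.
- exact: addrC.
- exact: add0r.
- exact: addNr.
Qed.

Definition tlift (x : tens_car) : G := teval (trep x).

Lemma tlift_cl u : tlift (tcl u) = teval u.
Proof. exact/teval_teq/trep_cl. Qed.
Lemma tlift_pure x y : tlift (pure x y) = f x y. Proof. exact: tlift_cl. Qed.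
Lemma tlift0 : tlift 0 = 0. Proof. exact: tlift_cl. Qed.
Lemma tliftD x y : tlift (x + y) = tlift x + tlift y.
Proof.
by elim/tcl_ind: x => u; elim/tcl_ind: y => v; rewrite [_ + _]tadd_cl !tlift_cl.
Qed.

End Lift.

Definition tlact (r : R) : tens_car -> tens_car :=
  tlift (fun x y => pure (lact r x) y).
Definition tract (x : tens_car) (t : T) : tens_car :=
  tlift (fun x y => pure x (ract y t)) x.

Lemma tlact_pure r x y : tlact r (pure x y) = pure (lact r x) y.
Proof.
rewrite /tlact tlift_pure // => *.
- by rewrite lactDr pureDl.
- by rewrite pureDr.
- by rewrite -lractA pure_bal.
Qed.
Lemma tlactD r x y : tlact r (x + y) = tlact r x + tlact r y.
Proof.
rewrite /tlact tliftD // => *.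
- by rewrite lactDr pureDl.
- by rewrite pureDr.
- by rewrite -lractA pure_bal.
Qed.
Lemma tlact0 r : tlact r 0 = 0.
Proof. by apply: (addIr (tlact r 0)); rewrite -tlactD !add0r. Qed.
Lemma tract_pure t x y : tract (pure x y) t = pure x (ract y t).
Proof.
rewrite /tract tlift_pure // => *.
- by rewrite pureDl.
- by rewrite ractDl pureDr.
- by rewrite pure_bal lractA.
Qed.
Lemma tractD t x y : tract (x + y) t = tract x t + tract y t.
Proof.
rewrite /tract tliftD // => *.
- by rewrite pureDl.
- by rewrite ractDl pureDr.
- by rewrite pure_bal lractA.
Qed.
Lemma tract0 t : tract 0 t = 0.
Proof. by apply: (addIr (tract 0 t)); rewrite -tractD !add0r. Qed.

Definition tens : bimod R T.
Proof.
exists tens_car tlact tract.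
- exact: tlactD.
- move=> r s; elim/tens_ind => [|x y|x y Hx Hy].
  + by rewrite !tlact0 addr0.
  + by rewrite !tlact_pure lactDl pureDl.
  + by rewrite !tlactD Hx Hy addrACA.
- move=> r s; elim/tens_ind => [|x y|x y Hx Hy].
  + by rewrite !tlact0.
  + by rewrite !tlact_pure lactM.
  + by rewrite !tlactD Hx Hy.
- elim/tens_ind => [|x y|x y Hx Hy].
  + by rewrite tlact0.
  + by rewrite tlact_pure lact1.
  + by rewrite tlactD Hx Hy.
- by move=> x y t; apply: tractD.
- move=> x r s; elim/tens_ind: x => [|x y|x y Hx Hy].
  + by rewrite !tract0 addr0.
  + by rewrite !tract_pure ractDr pureDr.
  + by rewrite !tractD Hx Hy addrACA.
- move=> x r s; elim/tens_ind: x => [|x y|x y Hx Hy].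
  + by rewrite !tract0.
  + by rewrite !tract_pure ractM.
  + by rewrite !tractD Hx Hy.
- elim/tens_ind => [|x y|x y Hx Hy].
  + by rewrite tract0.
  + by rewrite tract_pure ract1.
  + by rewrite tractD Hx Hy.
- move=> r x s; elim/tens_ind: x => [|x y|x y Hx Hy].
  + by rewrite tlact0 !tract0 tlact0.
  + by rewrite tlact_pure !tract_pure tlact_pure.
  + by rewrite tractD !tlactD tractD Hx Hy.
Defined.

(* the bimodule map x (x) y |-> f x y *)
Definition tmapof (P : bimod R T) (f : M -> N -> P)
    (fDl : forall x x' y, f (x + x') y = f x y + f x' y)
    (fDr : forall x y y', f x (y + y') = f x y + f x y')
    (fbal : forall x s y, f (ract x s) y = f x (lact s y))
    (fL : forall r x y, f (lact r x) y = lact r (f x y))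
    (fR : forall x y t, f x (ract y t) = ract (f x y) t) : bimap tens P.
Proof.
exists (tlift f).
- by move=> x y; rewrite tliftD.
- move=> r; elim/tens_ind => [|x y|x y Hx Hy].
  + by rewrite [lact r _]tlact0 tlift0 // lact0.
  + by rewrite [lact r _]tlact_pure !tlift_pure // fL.
  + by rewrite [lact r _]tlactD !tliftD // Hx Hy lactDr.
- move=> x t; elim/tens_ind: x => [|x y|x y Hx Hy].
  + by rewrite [ract _ _]tract0 tlift0 // ract0.
  + by rewrite [ract _ _]tract_pure !tlift_pure // fR.
  + by rewrite [ract _ _]tractD !tliftD // Hx Hy ractDl.
Defined.

Lemma tmapof_pure P f fDl fDr fbal fL fR x y :
  @tmapof P f fDl fDr fbal fL fR (pure x y) = f x y.
Proof. exact: tlift_pure. Qed.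

End Tensor.

(* f (x) g *)
Definition tmap (R S T : pzRingType) (M M' : bimod R S) (N N' : bimod S T)
  (f : bimap M M') (g : bimap N N') : bimap (tens M N) (tens M' N').
Proof.
apply: (@tmapof _ _ _ M N (tens M' N') (fun x y => pure (f x) (g y))).
- by move=> *; rewrite bmapD pureDl.
- by move=> *; rewrite bmapD pureDr.
- by move=> *; rewrite bmapR bmapL pure_bal.
- by move=> *; rewrite bmapL [RHS]tlact_pure.
- by move=> *; rewrite bmapR [RHS]tract_pure.
Defined.

Lemma tmap_pure R S T M M' N N' f g x y :
  @tmap R S T M M' N N' f g (pure x y) = pure (f x) (g y).
Proof. exact: tmapof_pure. Qed.

(* the associativity isomorphisms (M (x) N) (x) P <-> M (x) (N (x) P) *)
Section Associator.
Variables (R S T U : pzRingType).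
Variables (M : bimod R S) (N : bimod S T) (P : bimod T U).

Definition tassoc_fun (u : tens_car M N) (z : P) : tens M (tens N P) :=
  tlift (fun x y => pure x (pure y z : tens N P)) u.

Lemma tassoc_fun_pure z x y :
  tassoc_fun (pure x y) z = pure x (pure y z : tens N P).
Proof.
apply: tlift_pure => [x1 x2 y'|x' y1 y2|x' s y'].
- by rewrite pureDl.
- by rewrite pureDl pureDr.
- by rewrite pure_bal [lact s (_ : tens _ _)]tlact_pure.
Qed.
Lemma tassoc_funD z u v : tassoc_fun (u + v) z = tassoc_fun u z + tassoc_fun v z.
Proof.
apply: tliftD => [x1 x2 y'|x' y1 y2|x' s y'].
- by rewrite pureDl.
- by rewrite pureDl pureDr.
- by rewrite pure_bal [lact s (_ : tens _ _)]tlact_pure.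
Qed.
Lemma tassoc_fun0 z : tassoc_fun 0 z = 0.
Proof. by apply: (addIr (tassoc_fun 0 z)); rewrite -tassoc_funD !add0r. Qed.

Definition tassoc : bimap (tens (tens M N) P) (tens M (tens N P)).
Proof.
apply: (@tmapof _ _ _ (tens M N) P (tens M (tens N P)) tassoc_fun).
- by move=> u v z; rewrite tassoc_funD.
- move=> u z z'; elim/tens_ind: u => [|x y|u v Hu Hv].
  + by rewrite !tassoc_fun0 addr0.
  + by rewrite !tassoc_fun_pure pureDr pureDr.
  + by rewrite !tassoc_funD Hu Hv addrACA.
- move=> u t z; elim/tens_ind: u => [|x y|u v Hu Hv].
  + by rewrite [ract _ _]tract0 !tassoc_fun0.
  + by rewrite [ract _ _]tract_pure !tassoc_fun_pure pure_bal.
  + by rewrite [ract _ _]tractD !tassoc_funD Hu Hv.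
- move=> r u z; elim/tens_ind: u => [|x y|u v Hu Hv].
  + by rewrite [lact r _]tlact0 !tassoc_fun0 lact0.
  + by rewrite [lact r _]tlact_pure !tassoc_fun_pure [RHS]tlact_pure.
  + by rewrite [lact r _]tlactD !tassoc_funD Hu Hv lactDr.
- move=> u z t; elim/tens_ind: u => [|x y|u v Hu Hv].
  + by rewrite !tassoc_fun0 ract0.
  + rewrite !tassoc_fun_pure [RHS]tract_pure.
    by rewrite [ract (_ : tens N P) t]tract_pure.
  + by rewrite !tassoc_funD Hu Hv ractDl.
Defined.

Lemma tassoc_pure x y z :
  tassoc (pure (pure x y : tens M N) z) = pure x (pure y z : tens N P).
Proof. by rewrite [LHS]tmapof_pure tassoc_fun_pure. Qed.

Definition tassocV_fun (x : M) (u : tens_car N P) : tens (tens M N) P :=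
  tlift (fun y z => pure (pure x y : tens M N) z) u.

Lemma tassocV_fun_pure x y z :
  tassocV_fun x (pure y z) = pure (pure x y : tens M N) z.
Proof.
apply: tlift_pure => [y1 y2 z'|y' z1 z2|y' s z'].
- by rewrite pureDr pureDl.
- by rewrite pureDr.
- by rewrite -pure_bal [ract (_ : tens _ _) s]tract_pure.
Qed.
Lemma tassocV_funD x u v :
  tassocV_fun x (u + v) = tassocV_fun x u + tassocV_fun x v.
Proof.
apply: tliftD => [y1 y2 z'|y' z1 z2|y' s z'].
- by rewrite pureDr pureDl.
- by rewrite pureDr.
- by rewrite -pure_bal [ract (_ : tens _ _) s]tract_pure.
Qed.
Lemma tassocV_fun0 x : tassocV_fun x 0 = 0.
Proof. by apply: (addIr (tassocV_fun x 0)); rewrite -tassocV_funD !add0r. Qed.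

Definition tassocV : bimap (tens M (tens N P)) (tens (tens M N) P).
Proof.
apply: (@tmapof _ _ _ M (tens N P) (tens (tens M N) P) tassocV_fun).
- move=> x x' u; elim/tens_ind: u => [|y z|u v Hu Hv].
  + by rewrite !tassocV_fun0 addr0.
  + by rewrite !tassocV_fun_pure pureDl pureDl.
  + by rewrite !tassocV_funD Hu Hv addrACA.
- by move=> x u v; rewrite tassocV_funD.
- move=> x s u; elim/tens_ind: u => [|y z|u v Hu Hv].
  + by rewrite [lact _ _]tlact0 !tassocV_fun0.
  + by rewrite [lact _ _]tlact_pure !tassocV_fun_pure pure_bal.
  + by rewrite [lact _ _]tlactD !tassocV_funD Hu Hv.
- move=> r x u; elim/tens_ind: u => [|y z|u v Hu Hv].
  + by rewrite !tassocV_fun0 lact0.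
  + rewrite !tassocV_fun_pure [RHS]tlact_pure.
    by rewrite [lact r (_ : tens M N)]tlact_pure.
  + by rewrite !tassocV_funD Hu Hv lactDr.
- move=> x u t; elim/tens_ind: u => [|y z|u v Hu Hv].
  + by rewrite [ract _ _]tract0 !tassocV_fun0 ract0.
  + by rewrite [ract _ _]tract_pure !tassocV_fun_pure [RHS]tract_pure.
  + by rewrite [ract _ _]tractD !tassocV_funD Hu Hv ractDl.
Defined.

Lemma tassocV_pure x y z :
  tassocV (pure x (pure y z : tens N P)) = pure (pure x y : tens M N) z.
Proof. by rewrite [LHS]tmapof_pure tassocV_fun_pure. Qed.

End Associator.

Section HeckeBimodules.
Variables (A : comPzRingType) (q : A).
Local Notation H := (@Defs_hecke__canonical__GRing_PzRing A q).
Local Notation t := (ht q).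

(* _k(n)_l : H_n as an (H_k, H_l)-bimodule *)
Definition hbim (k n l : nat) (hk : (k <= n)%N) (hl : (l <= n)%N) :
  bimod (H k) (H l).
Proof.
exists (hecke q n) (fun r x => incl q hk r * x) (fun x s => x * incl q hl s).
- by move=> *; rewrite mulrDr.
- by move=> *; rewrite rmorphD mulrDl.
- by move=> *; rewrite rmorphM mulrA.
- by move=> *; rewrite rmorph1 mul1r.
- by move=> *; rewrite mulrDl.
- by move=> *; rewrite rmorphD mulrDr.
- by move=> *; rewrite rmorphM mulrA.
- by move=> *; rewrite rmorph1 mulr1.
- by move=> *; rewrite mulrA.
Defined.

Lemma lact_hbim k n l (hk : (k <= n)%N) (hl : (l <= n)%N) r (x : hbim hk hl) :
  lact r x = incl q hk r * x.
Proof. by []. Qed.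
Lemma ract_hbim k n l (hk : (k <= n)%N) (hl : (l <= n)%N) s (x : hbim hk hl) :
  ract x s = x * incl q hl s.
Proof. by []. Qed.

(* multiplication by a scalar of the base ring on a left H_n-module *)
Definition bscale n (S : pzRingType) (M : bimod (H n) S) (a : A) (x : M) : M :=
  lact (hcst q n a) x.

(* the standard isomorphism between _k(n)_m (x) _m(m)_l and _k(n)_l, in both
   directions *)
Section StandardIso.
Variables (k n m l : nat).
Variables (hk : (k <= n)%N) (hm : (m <= n)%N) (hl : (l <= m)%N).
Variable hln : (l <= n)%N.

Definition tcollapse :
  bimap (tens (hbim hk hm) (hbim (leqnn m) hl)) (hbim hk hln).
Proof.
apply: (@tmapof _ _ _ (hbim hk hm) (hbim (leqnn m) hl) (hbim hk hln)
  (fun x y => (x : H n) * incl q hm y)) => [x x' y|x y y'|x s y|r x y|x y s].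
- by rewrite mulrDl.
- by rewrite rmorphD mulrDr.
- by rewrite !(lact_hbim, ract_hbim) rmorphM incl_id mulrA.
- by rewrite !lact_hbim mulrA.
- by rewrite !ract_hbim rmorphM (incl_comp hl hm hln) mulrA.
Defined.

Lemma tcollapse_pure x y : tcollapse (pure x y) = (x : H n) * incl q hm y.
Proof. exact: tmapof_pure. Qed.

Definition texpand :
  bimap (hbim hk hln) (tens (hbim hk hm) (hbim (leqnn m) hl)).
Proof.
exists (fun x => @pure _ _ _ (hbim hk hm) (hbim (leqnn m) hl) x (1 : H m)).
- by move=> x y; rewrite pureDl.
- by move=> r x; rewrite [RHS]tlact_pure.
- move=> x s; rewrite [RHS]tract_pure !ract_hbim mul1r.
  rewrite -(incl_comp hl hm hln).
  by rewrite -[x * _]/(ract (x : hbim hk hm) _) pure_bal lact_hbim incl_id mulr1.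
Defined.

Lemma texpandE x :
  texpand x = @pure _ _ _ (hbim hk hm) (hbim (leqnn m) hl) x (1 : H m).
Proof. by []. Qed.

Lemma texpandK x : tcollapse (texpand x) = x.
Proof. by rewrite texpandE tcollapse_pure rmorph1 mulr1. Qed.

Lemma tcollapseK u : texpand (tcollapse u) = u.
Proof.
elim/tens_ind: u => [|x y|u v Hu Hv].
- by rewrite [tcollapse 0]bmap0 bmap0.
- rewrite tcollapse_pure texpandE -[_ * _]ract_hbim pure_bal lact_hbim.
  by rewrite incl_id mulr1.
- by rewrite [tcollapse _]bmapD bmapD Hu Hv.
Qed.
End StandardIso.

(* f (x) id_{(m)_l}, for f : _k(n)_m -> _k(n')_m *)
Definition whisker_r k n n' m l
    (hk : (k <= n)%N) (hm : (m <= n)%N) (hk' : (k <= n')%N) (hm' : (m <= n')%N)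
    (f : bimap (hbim hk hm) (hbim hk' hm'))
    (hl : (l <= m)%N) (hln : (l <= n)%N) (hln' : (l <= n')%N) :
    bimap (hbim hk hln) (hbim hk' hln') :=
  tcollapse hk' hm' hl hln' \b tmap f (bid (hbim (leqnn m) hl))
    \b texpand hk hm hl hln.

(* id_{_k(n)_m} (x) f, for f : (m)_l -> (m)_l *)
Definition whisker_l k n m l (hk : (k <= n)%N) (hm : (m <= n)%N)
    (hl : (l <= m)%N) (f : bimap (hbim (leqnn m) hl) (hbim (leqnn m) hl))
    (hln : (l <= n)%N) :
    bimap (hbim hk hln) (hbim hk hln) :=
  tcollapse hk hm hl hln \b tmap (bid (hbim hk hm)) f \b texpand hk hm hl hln.

Lemma leqS2 n : (n <= n.+2)%N. Proof. exact: leqW. Qed.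
Lemma leqS3 n : (n <= n.+3)%N. Proof. exact/leqW/leqS2. Qed.

(* The bimodules B_eps(n), in the form given by the standard isomorphisms. *)
Definition B_nil n : bimod (H n) (H n) := hbim (leqnn n) (leqnn n).
Definition B_p n : bimod (H n.+1) (H n) := hbim (leqnn n.+1) (leqnSn n).
Definition B_pp n : bimod (H n.+2) (H n) := hbim (leqnn n.+2) (leqS2 n).
Definition B_ppp n : bimod (H n.+3) (H n) := hbim (leqnn n.+3) (leqS3 n).
Definition B_mp n : bimod (H n) (H n) := hbim (leqnSn n) (leqnSn n).
Definition B_mpp n : bimod (H n.+1) (H n) := hbim (leqnSn n.+1) (leqS2 n).
(* For n = 0 the label becomes negative. *)
Definition B_pm n : bimod (H n) (H n) :=
  match n with
  | 0 => bimod0 _ _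
  | m.+1 => tens (hbim (leqnn m.+1) (leqnSn m)) (hbim (leqnSn m) (leqnn m.+1))
  end.
Definition B_mppm n : bimod (H n) (H n) :=
  match n with
  | 0 => bimod0 _ _
  | m.+1 => tens (hbim (leqnSn m.+1) (leqS2 m)) (hbim (leqnSn m) (leqnn m.+1))
  end.

Definition RCap n : bimap (B_pm n) (B_nil n).
Proof.
case: n => [|m]; first exact: bzero.
apply: (@tmapof _ _ _ (hbim (leqnn m.+1) (leqnSn m))
  (hbim (leqnSn m) (leqnn m.+1)) (B_nil m.+1)
  (fun x y => (x : H m.+1) * y)) => *.
- by rewrite mulrDl.
- by rewrite mulrDr.
- by rewrite ract_hbim lact_hbim mulrA.
- by rewrite !lact_hbim mulrA.
- by rewrite !ract_hbim mulrA.
Defined.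

Lemma RCap_pure m (x : hbim (leqnn m.+1) (leqnSn m))
  (y : hbim (leqnSn m) (leqnn m.+1)) : RCap m.+1 (pure x y) = (x : H m.+1) * y.
Proof. exact: tmapof_pure. Qed.

Definition RCup n : bimap (B_nil n) (B_mp n).
Proof.
exists (fun z : B_nil n => incl q (leqnSn n) z : B_mp n) => [x y|r x|x s].
- by rewrite rmorphD.
- by rewrite !lact_hbim rmorphM incl_id.
- by rewrite !ract_hbim rmorphM incl_id.
Defined.

(* t_(n+1) centralizes H_n in H_(n+2) *)
Lemma t_incl_comm n x :
  t n.+2 n.+1 * incl q (leqS2 n) x = incl q (leqS2 n) x * t n.+2 n.+1.
Proof.
elim/hecke_ind: x => [a|i /andP[i0 iN]|x y Hx Hy|x y Hx Hy].
- by rewrite incl_cst hcst_comm.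
- by rewrite incl_t ?i0 // (@ht_comm _ q) //; lia.
- by rewrite rmorphD mulrDl mulrDr Hx Hy.
- by rewrite rmorphM mulrA Hx -!mulrA Hy.
Qed.

Definition X n : bimap (B_pp n) (B_pp n).
Proof.
exists (fun z : H n.+2 => z * t n.+2 n.+1 : B_pp n) => [x y|r x|x s].
- by rewrite mulrDl.
- by rewrite !lact_hbim mulrA.
- by rewrite !ract_hbim -!mulrA t_incl_comm.
Defined.

(* t_i t_(i+1) ... t_(n-1) and t_(n-1) ... t_(i+1) t_i in H_n *)
Definition tup n i : H n := \prod_(i <= j < n) t n j.
Definition tdown n i : H n := \prod_(j <- rev (index_iota i n)) t n j.

Lemma tup_geq n i : (n <= i)%N -> tup n i = 1.
Proof. by move=> h; rewrite /tup big_geq. Qed.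
Lemma tup_lt n i : (i < n)%N -> tup n i = t n i * tup n i.+1.
Proof. by move=> h; rewrite /tup big_ltn. Qed.
Lemma tdown_geq n i : (n <= i)%N -> tdown n i = 1.
Proof.
by move=> h; rewrite /tdown /index_iota (eqP h : (n - i = 0)%N) big_nil.
Qed.
Lemma tdown_lt n i : (i < n)%N -> tdown n i = tdown n i.+1 * t n i.
Proof.
move=> h; rewrite /tdown /index_iota -(subnSK h) /= rev_cons -cats1 big_cat /=.
by rewrite big_seq1.
Qed.

(* descending induction *)
Lemma tup_comm_lt n i j : (0 < j)%N -> (j.+1 < i)%N ->
  t n j * tup n i = tup n i * t n j.
Proof.
move=> j0; move: i; suff P d i : (n - i = d)%N -> (j.+1 < i)%N ->
  t n j * tup n i = tup n i * t n j by move=> i; apply: P erefl.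
elim: d i => [|d IH] i hd ij.
  by rewrite !tup_geq ?mul1r ?mulr1 //; apply/eqP.
have iN : (i < n)%N by lia.
rewrite tup_lt // mulrA (@ht_comm _ q n j i) ?j0 /=; try lia.
by rewrite -!mulrA IH //; lia.
Qed.

Lemma tdown_comm_lt n i j : (0 < j)%N -> (j.+1 < i)%N ->
  t n j * tdown n i = tdown n i * t n j.
Proof.
move=> j0; move: i; suff P d i : (n - i = d)%N -> (j.+1 < i)%N ->
  t n j * tdown n i = tdown n i * t n j by move=> i; apply: P erefl.
elim: d i => [|d IH] i hd ij.
  by rewrite !tdown_geq ?mul1r ?mulr1 //; apply/eqP.
have iN : (i < n)%N by lia.
rewrite tdown_lt // mulrA IH ?(leqW ij) //; last lia.
by rewrite -!mulrA (@ht_comm _ q n j i) ?j0 //=; lia.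
Qed.

Lemma tup_comm_gt n i j : (0 < i)%N -> (i <= j)%N -> (j.+1 < n)%N ->
  t n j.+1 * tup n i = tup n i * t n j.
Proof.
move=> i0 ij jn; have [d dE] : exists d, (j - i = d)%N by exists (j - i)%N.
elim: d i i0 ij dE => [|d IH] i i0 ij dE.
  have -> : i = j by lia.
  rewrite tup_lt; last lia.
  rewrite tup_lt //.
  have cb := @ht_braid _ q n j; rewrite !mulrA in cb.
  rewrite !mulrA -cb; try lia.
  by rewrite -!mulrA tup_comm_lt //; lia.
rewrite tup_lt; last lia.
rewrite mulrA -(@ht_comm _ q n i j.+1); try lia.
by rewrite -!mulrA IH //; lia.
Qed.

Lemma tdown_comm_gt n i j : (0 < i)%N -> (i <= j)%N -> (j.+1 < n)%N ->
  tdown n i * t n j.+1 = t n j * tdown n i.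
Proof.
move=> i0 ij jn; have [d dE] : exists d, (j - i = d)%N by exists (j - i)%N.
elim: d i i0 ij dE => [|d IH] i i0 ij dE.
  have -> : i = j by lia.
  rewrite tdown_lt; last lia.
  rewrite tdown_lt //.
  have cb := @ht_braid _ q n j.
  rewrite -!mulrA -cb; try lia.
  by rewrite !mulrA tdown_comm_lt //; lia.
rewrite tdown_lt; last lia.
rewrite -mulrA (@ht_comm _ q n i j.+1); try lia.
by rewrite !mulrA IH //; lia.
Qed.

(* x (x) y in B_pm(m+1) = (m+1)_m (x) _m(m+1) *)
Definition pure_pm m (x y : H m.+1) : B_pm m.+1 :=
  @pure _ _ _ (hbim (leqnn m.+1) (leqnSn m)) (hbim (leqnSn m) (leqnn m.+1)) x y.

Lemma lact_pm m a (x y : H m.+1) : lact a (pure_pm x y) = pure_pm (a * x) y.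
Proof. by rewrite [LHS]tlact_pure lact_hbim incl_id. Qed.
Lemma ract_pm m a (x y : H m.+1) : ract (pure_pm x y) a = pure_pm x (y * a).
Proof. by rewrite [LHS]tract_pure ract_hbim incl_id. Qed.
Lemma pm_bal m a (x y : H m.+1) :
  pure_pm (x * incl q (leqnSn m) a) y = pure_pm x (incl q (leqnSn m) a * y).
Proof. exact: pure_bal. Qed.
Lemma pm_Dl m (x x' y : H m.+1) :
  pure_pm (x + x') y = pure_pm x y + pure_pm x' y.
Proof. exact: pureDl. Qed.
Lemma pm_Dr m (x y y' : H m.+1) :
  pure_pm x (y + y') = pure_pm x y + pure_pm x y'.
Proof. exact: pureDr. Qed.
Lemma pm_cstr m a (x y : H m.+1) :
  pure_pm x (hcst q _ a * y) = pure_pm (hcst q _ a * x) y.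
Proof. by rewrite [in RHS]hcst_comm -(incl_cst q (leqnSn m)) pm_bal. Qed.
Lemma RCap_pm m (x y : H m.+1) : RCap m.+1 (pure_pm x y) = x * y.
Proof. exact: RCap_pure. Qed.

Section LeftCup.
Variable (qV : A).
Hypothesis hq : q * qV = 1.
Variable m : nat.
Let n := m.+1.

Definition cas_term i : B_pm n :=
  lact (hcst q n (qV ^+ (n - i))) (pure_pm (tup n i) (tdown n i)).

(* the image of 1 under LCup *)
Definition casimir : B_pm n := \sum_(1 <= i < n.+1) cas_term i.

Let cas_comm j : (0 < j < n)%N -> lact (t n j) casimir = ract casimir (t n j).
Proof.
move=> /andP[j0 jn].
have lsum x (r : seq nat) F : lact x (\sum_(i <- r) F i : B_pm n) =
    \sum_(i <- r) lact x (F i : B_pm n).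
  by elim/big_rec2: _ => [|i u v _ <-]; rewrite ?lact0 ?lactDr.
have rsum x (r : seq nat) F : ract (\sum_(i <- r) F i : B_pm n) x =
    \sum_(i <- r) ract (F i : B_pm n) x.
  by elim/big_rec2: _ => [|i u v _ <-]; rewrite ?ract0 ?ractDl.
have ltE i : lact (t n j) (cas_term i) = lact (hcst q n (qV ^+ (n - i)))
    (pure_pm (t n j * tup n i) (tdown n i)).
  by rewrite /cas_term -lactM -hcst_comm lactM lact_pm.
have rtE i : ract (cas_term i) (t n j) = lact (hcst q n (qV ^+ (n - i)))
    (pure_pm (tup n i) (tdown n i * t n j)).
  by rewrite /cas_term lractA ract_pm.
rewrite /casimir lsum rsum.
rewrite (@big_cat_nat _ _ _ j) //; last lia.
rewrite [RHS](@big_cat_nat _ _ _ j) //; last lia.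
congr (_ + _).
  rewrite big_nat_cond [RHS]big_nat_cond; apply: eq_bigr => i.
  rewrite andbT => /andP[i0 ij]; rewrite ltE rtE.
  case: j j0 jn ij {ltE rtE} => // j _ jn ij.
  case: j jn ij => [|j] jn ij; first lia.
  rewrite tup_comm_gt // tdown_comm_gt //.
  have <- : incl q (leqnSn m) (t m j.+1) = t n j.+1 by rewrite incl_t //; lia.
  by rewrite pm_bal.
have split2 (F : nat -> B_pm n) : \sum_(j <= i < n.+1) F i =
    (F j + F j.+1) + \sum_(j.+2 <= i < n.+1) F i.
  by rewrite big_ltn; [rewrite big_ltn ?addrA //; lia | lia].
rewrite !split2; congr (_ + _); last first.
  rewrite big_nat_cond [RHS]big_nat_cond; apply: eq_bigr => i.
  rewrite andbT => /andP[ij iN]; rewrite ltE rtE tup_comm_lt //.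
  rewrite -tdown_comm_lt //.
  have <- : incl q (leqnSn m) (t m j) = t n j by rewrite incl_t //; lia.
  by rewrite pm_bal.
rewrite !ltE !rtE !(tup_lt jn) !(tdown_lt jn).
set u := tup n j.+1; set v := tdown n j.+1.
have -> : hcst q n (qV ^+ (n - j.+1)) = hcst q n (qV ^+ (n - j)) * hcst q n q.
  by rewrite -rmorphM -(subnSK jn) exprS mulrC mulrA hq mul1r.
rewrite !lactM -!lactDr; congr (lact _ _).
rewrite !lact_pm mulrA -[v * _ * _]mulrA !ht_quad ?j0 //.
rewrite mulrDl mulrDr !pm_Dl !pm_Dr.
rewrite -(hcst_comm q v) [v * (_ * _)]mulrA -(hcst_comm (q - 1) v).
rewrite -[_ * v * _]mulrA !pm_cstr -!mulrA.
by rewrite addrC addrAC -!addrA.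
Qed.

Lemma lact_casimir x : lact x casimir = ract casimir x.
Proof.
elim/hecke_ind: x => [a|i hi|x y Hx Hy|x y Hx Hy].
- have lsum (r : seq nat) (F : nat -> B_pm n) :
    lact (hcst q n a) (\sum_(i <- r) F i) = \sum_(i <- r) lact (hcst q n a) (F i).
    by elim/big_rec2: _ => [|i u v _ <-]; rewrite ?lact0 ?lactDr.
  have rsum (r : seq nat) (F : nat -> B_pm n) :
    ract (\sum_(i <- r) F i) (hcst q n a) = \sum_(i <- r) ract (F i) (hcst q n a).
    by elim/big_rec2: _ => [|i u v _ <-]; rewrite ?ract0 ?ractDl.
  rewrite lsum rsum; apply: eq_bigr => i _.
  rewrite /cas_term lractA -lactM hcst_comm lactM; congr (lact _ _).
  by rewrite lact_pm ract_pm -hcst_comm pm_cstr.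
- exact: cas_comm.
- by rewrite lactDl ractDr Hx Hy.
- by rewrite lactM ractM -Hx Hy lractA.
Qed.

End LeftCup.

Definition LCup (qV : A) (hq : q * qV = 1) n : bimap (B_nil n) (B_pm n).
Proof.
case: n => [|m]; first exact: bzero.
exists (fun z : H m.+1 => lact z (casimir qV m)) => [x y|r x|x s].
- by rewrite lactDl.
- by rewrite lact_hbim incl_id lactM.
- by rewrite ract_hbim incl_id lactM lact_casimir // lractA.
Defined.

Lemma LCupE (qV : A) (hq : q * qV = 1) m (z : H m.+1) :
  LCup hq m.+1 z = lact z (casimir qV m).
Proof. by []. Qed.

(* H_(n+1) acts on the right on the free left H_n-module with basis e_i,
   0 < i <= n+1, in the way e_i = t_n t_(n-1) ... t_i would; v : nat -> H_n
   encodes \sum_i v_i e_i. *)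
Section CapAction.
Variable n : nat.
Implicit Types (v w : nat -> H n) (u : hterm A n.+1).

Definition gact (j : nat) v (i : nat) : H n :=
  if (j.+1 < i)%N then v i * t n j
  else if j.+1 == i then v j * hcst q n q
  else if j == i then v i.+1 + v i * hcst q n (q - 1)
  else v i * t n j.-1.

Fixpoint vact u v : nat -> H n :=
  match u with
  | HCst a => fun i => v i * hcst q n a
  | HGen j => gact (val j) v
  | HAdd u1 u2 => fun i => vact u1 v i + vact u2 v i
  | HMul u1 u2 => vact u2 (vact u1 v)
  end.

Definition veq v w := forall i, (0 < i <= n.+1)%N -> v i = w i.

Lemma gact_ext j v w : (0 < j <= n)%N -> veq v w -> veq (gact j v) (gact j w).
Proof.
move=> hj vw i hi; rewrite /gact vw // -(vw j); last lia.
case: ifP => // _; case: ifP => // _; case: ifP => // /eqP ji.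
by rewrite vw //; lia.
Qed.

Lemma vact_ext u v w : veq v w -> veq (vact u v) (vact u w).
Proof.
elim: u v w => [a|[j hj]|u1 IH1 u2 IH2|u1 IH1 u2 IH2] v w vw /=.
- by move=> i hi; rewrite vw.
- exact: gact_ext.
- by move=> i hi; rewrite (IH1 v w) // (IH2 v w).
- exact/IH2/IH1.
Qed.

Lemma vactD u v w : vact u (fun i => v i + w i) =1 (fun i => vact u v i + vact u w i).
Proof.
have ext u1 v1 v2 : v1 =1 v2 -> vact u1 v1 =1 vact u1 v2.
  by move=> /funext ->.
elim: u v w => [a|[j hj]|u1 IH1 u2 IH2|u1 IH1 u2 IH2] v w i /=.
- by rewrite mulrDl.
- rewrite /gact; do ![case: ifP => _]; rewrite ?mulrDl //.
  by rewrite addrACA.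
- by rewrite IH1 IH2 addrACA.
- by rewrite (ext _ _ _ (IH1 v w)) IH2.
Qed.

Lemma vactZ u x v : vact u (fun i => x * v i) =1 (fun i => x * vact u v i).
Proof.
elim: u v => [a|[j hj]|u1 IH1 u2 IH2|u1 IH1 u2 IH2] v i /=.
- by rewrite mulrA.
- rewrite /gact; do ![case: ifP => _]; rewrite ?mulrA //.
  by rewrite mulrDr mulrA.
- by rewrite IH1 IH2 mulrDr.
- by rewrite (funext (IH1 v)) IH2.
Qed.

Lemma gact_hi j v i : (j.+1 < i)%N -> gact j v i = v i * t n j.
Proof. by move=> h; rewrite /gact h. Qed.
Lemma gact_S j v : gact j v j.+1 = v j * hcst q n q.
Proof. by rewrite /gact ltnn eqxx. Qed.
Lemma gact_eq j v : gact j v j = v j.+1 + v j * hcst q n (q - 1).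
Proof.
by rewrite /gact eqxx; case: ifP => [|_]; [lia | case: ifP => //; lia].
Qed.
Lemma gact_lo j v i : (i < j)%N -> gact j v i = v i * t n j.-1.
Proof. by move=> h; rewrite /gact; do ![case: ifP => [|_]; first lia]. Qed.

Lemma hcst_swap (a : A) (x : H n) i :
  x * hcst q n a * t n i = x * t n i * hcst q n a.
Proof. by rewrite -!mulrA hcst_comm. Qed.
Lemma hcst_swap2 (a b : A) (x : H n) :
  x * hcst q n a * hcst q n b = x * hcst q n b * hcst q n a.
Proof. by rewrite -!mulrA hcst_comm. Qed.

Lemma gact_quad j v : (0 < j <= n)%N ->
  veq (gact j (gact j v)) (fun i => v i * hcst q n q + gact j v i * hcst q n (q - 1)).
Proof.
move=> hj i hi; have [ji|ij|/esym ->] := ltngtP j i.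
- have [ji'|ij'|<-] := ltngtP j.+1 i; [|lia|].
    rewrite !gact_hi // -mulrA ht_quad; last lia.
    by rewrite mulrDr !mulrA -hcst_swap.
  by rewrite !gact_S gact_eq mulrDl hcst_swap2.
- rewrite !gact_lo // -mulrA ht_quad; last lia.
  by rewrite mulrDr !mulrA -hcst_swap.
- by rewrite gact_eq gact_S.
Qed.

Lemma gact_far j l v : (0 < j)%N -> (j.+1 < l)%N -> (l <= n)%N ->
  veq (gact l (gact j v)) (gact j (gact l v)).
Proof.
move=> j0 jl ln i hi.
have [il|il|->] := ltngtP i l; last first.
- rewrite gact_eq !(@gact_hi j) //; last lia.
  by rewrite gact_eq mulrDl hcst_swap.
- have [ji'|ij'|<-] := ltngtP l.+1 i; [|lia|].
    rewrite !gact_hi //; try lia.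
    by rewrite -!mulrA (@ht_comm _ q n j l) //; lia.
  rewrite gact_S !(@gact_hi j) //; try lia.
  by rewrite gact_S hcst_swap.
rewrite (@gact_lo l) //.
have [ji|ij|<-] := ltngtP j.+1 i.
- rewrite !(@gact_hi j) // gact_lo // -!mulrA (@ht_comm _ q n j l.-1) //; lia.
- have [ij1|ij2|->] := ltngtP i j; [|lia|].
    rewrite !gact_lo // -!mulrA (@ht_comm _ q n j.-1 l.-1) //; lia.
  rewrite !gact_eq !gact_lo //; try lia.
  by rewrite mulrDl hcst_swap.
- by rewrite !gact_S gact_lo ?hcst_swap //; lia.
Qed.

Lemma gact_braid j v : (0 < j < n)%N ->
  veq (gact j (gact j.+1 (gact j v))) (gact j.+1 (gact j (gact j.+1 v))).
Proof.
move=> hj i hi; have [ij|ij|->] := ltngtP i j.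
- rewrite !gact_lo //; try lia.
  case: j hj ij => [|[|j]] hj ij; try lia.
  by rewrite -!mulrA -ht_braid //=; lia.
- have [ij1|ij1|->] := ltngtP i j.+1; first lia; last first.
    rewrite gact_S (@gact_lo j.+1) ?ltnSn // gact_eq gact_eq.
    rewrite gact_hi // gact_S gact_S gact_lo //=.
    by rewrite !mulrDl !hcst_swap [v j * _ * _ * _]hcst_swap2.
  have [ij2|ij2|->] := ltngtP i j.+2; first lia; last first.
    by rewrite gact_S gact_hi // !gact_S gact_lo //= !hcst_swap.
  rewrite !gact_hi //.
  by rewrite -!mulrA ht_braid //; lia.
- rewrite gact_eq gact_eq (@gact_hi j) // gact_S (@gact_lo j.+1) // gact_eq.
  rewrite (@gact_lo j.+1 (gact j _)) // gact_eq gact_eq gact_lo //=.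
  rewrite !mulrDl -addrA -[RHS]addrA; congr (_ + _).
  rewrite !hcst_swap -[v j * t n j * t n j]mulrA ht_quad; last lia.
  by rewrite mulrDr mulrDl !mulrA hcst_swap addrCA.
Qed.

Lemma vact_heq u u' : heq q u u' -> forall v, veq (vact u v) (vact u' v).
Proof.
elim=> {u u'} /=.
- by [].
- by move=> x y _ IH v i hi; rewrite IH.
- by move=> x y z _ IH1 _ IH2 v i hi; rewrite IH1 ?IH2.
- by move=> x x' y y' _ IH1 _ IH2 v i hi; rewrite IH1 ?IH2.
- move=> x x' y y' _ IH1 _ IH2 v i hi; rewrite IH2 //.
  by apply: vact_ext => //; apply: IH1.
- by move=> x y z v i hi; rewrite addrA.
- by move=> x y v i hi; rewrite addrC.
- by move=> x v i hi; rewrite rmorph0 mulr0 add0r.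
- by [].
- by move=> x v i hi; apply: vact_ext => // k hk; rewrite rmorph1 mulr1.
- move=> x v i hi; rewrite rmorph0 mulr0.
  transitivity (vact x (fun k => 0 * v k) i); last by rewrite vactZ mul0r.
  by apply: vact_ext => // k hk; rewrite mulr0 mul0r.
- by move=> x y z v i hi; rewrite vactD.
- by [].
- by move=> a b v i hi; rewrite rmorphD mulrDr.
- by move=> a b v i hi; rewrite rmorphM mulrA.
- move=> a x v i hi; rewrite -hcst_comm -vactZ.
  by apply: vact_ext => // k hk; rewrite hcst_comm.
- move=> [j hj] v i hi /=; rewrite gact_quad //; congr (_ + _).
  rewrite -hcst_comm -(vactZ (HGen _ (exist _ j hj))) /=.
  by apply: gact_ext => // k hk; rewrite hcst_comm.
- move=> [j hj] [l hl] /= jl v i hi.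
  by apply: gact_far => //; clear -hj hl jl; lia.
- move=> [j hj] [l hl] /= jl v i hi; subst l.
  by rewrite gact_braid //; lia.
Qed.


Definition hact (z : H n.+1) v : nat -> H n := vact (hrep z) v.

Lemma hact_cl u v : veq (hact (hcl q u) v) (vact u v).
Proof. exact/vact_heq/hrep_cl. Qed.
Lemma hact_cst a v : veq (hact (hcst q n.+1 a) v) (fun i => v i * hcst q n a).
Proof. exact: hact_cl. Qed.
Lemma hact_t j v : (0 < j <= n)%N -> veq (hact (t n.+1 j) v) (gact j v).
Proof.
move=> hj; rewrite -[j]/(val (Sub j hj : hidx n.+1)) ht_gen; exact: hact_cl.
Qed.
Lemma hactD x y v : veq (hact (x + y) v) (fun i => hact x v i + hact y v i).
Proof.
move=> i hi; elim/hcl_ind: x => x; elim/hcl_ind: y => y.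
by rewrite -hcl_add !hact_cl.
Qed.
Lemma hact_ext x v w : veq v w -> veq (hact x v) (hact x w).
Proof. exact: vact_ext. Qed.
Lemma hactM x y v : veq (hact (x * y) v) (hact y (hact x v)).
Proof.
move=> i hi; elim/hcl_ind: x => x; elim/hcl_ind: y => y.
rewrite -hcl_mul !hact_cl //=; apply: vact_ext => // k hk.
by rewrite hact_cl.
Qed.
Lemma hactZ z x v : hact z (fun i => x * v i) =1 (fun i => x * hact z v i).
Proof. exact: vactZ. Qed.

(* the coordinates of e_(n+1) = 1 *)
Definition cap_e (i : nat) : H n := (i == n.+1)%:R.

Let top_ok : (0 < n.+1 <= n.+1)%N. Proof. by rewrite ltnSn. Qed.

Lemma hact_incl_e h :
  veq (hact (incl q (leqnSn n) h) cap_e) (fun i => h * cap_e i).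
Proof.
elim/hecke_ind: h => [a|j hj|x y Hx Hy|x y Hx Hy] i hi.
- by rewrite incl_cst hact_cst // hcst_comm.
- rewrite incl_t // hact_t //; last by case/andP: hj => -> /ltnW.
  have [->|ne] := eqVneq i n.+1.
    by rewrite gact_hi /cap_e ?eqxx ?mul1r ?mulr1 //; case/andP: hj.
  rewrite /gact /cap_e (negPf ne) mulr0.
  have -> : (j == n.+1) = false by apply/eqP => je; move: hj; rewrite je; lia.
  case: ifP => _; first by rewrite mul0r.
  case: ifP => _; first by rewrite mul0r.
  case: ifP => [/eqP ji|_]; last by rewrite mul0r.
  have -> : (i.+1 == n.+1) = false by apply/eqP; move: hj; rewrite ji; lia.
  by rewrite mul0r addr0.
- by rewrite rmorphD hactD // Hx // Hy // mulrDl.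
- by rewrite rmorphM hactM // (hact_ext _ Hx) // hactZ Hy // mulrA.
Qed.

Lemma hact_incl_top h v :
  hact (incl q (leqnSn n) h) v n.+1 = v n.+1 * h.
Proof.
elim/hecke_ind: h v => [a|j hj|x y Hx Hy|x y Hx Hy] v.
- by rewrite incl_cst hact_cst.
- rewrite incl_t // hact_t //; last by case/andP: hj => -> /ltnW.
  by rewrite gact_hi //; case/andP: hj.
- by rewrite rmorphD hactD // Hx // Hy // mulrDr.
- by rewrite rmorphM hactM // Hy Hx mulrA.
Qed.

Definition cap_fun (z : H n.+1) : H n := hact z cap_e n.+1.

Lemma LCap_exists : exists f : bimap (B_mp n) (B_nil n),
  (forall z, f (incl q (leqnSn n) z) = z) /\ ((0 < n)%N -> f (t n.+1 n) = 0).
Proof.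
have capD x y : cap_fun (x + y) = cap_fun x + cap_fun y by apply: hactD.
have capL r (x : B_mp n) :
    cap_fun (lact r x) = lact r (cap_fun x : B_nil n).
  rewrite !lact_hbim incl_id /cap_fun hactM //.
  by rewrite (hact_ext _ (hact_incl_e r)) // hactZ.
have capR (x : B_mp n) s : cap_fun (ract x s) = ract (cap_fun x : B_nil n) s.
  by rewrite !ract_hbim incl_id /cap_fun hactM // hact_incl_top.
exists (@Bimap _ _ (B_mp n) (B_nil n) cap_fun capD capL capR); split=> [z|n0].
  by rewrite /= /cap_fun hact_incl_e // /cap_e eqxx mulr1.
rewrite /= /cap_fun hact_t ?n0 ?leqnn // gact_S /cap_e.
by rewrite ltn_eqF // mul0r.
Qed.

End CapAction.

(* H_(n+1) = H_n + H_n t_n H_n *)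
Inductive cap_span n : H n.+1 -> Prop :=
| cap_span_incl x : cap_span (incl q (leqnSn n) x)
| cap_span_mid x y :
    cap_span (incl q (leqnSn n) x * t n.+1 n * incl q (leqnSn n) y)
| cap_span_add z w : cap_span z -> cap_span w -> cap_span (z + w).

Lemma cap_spanP n z : @cap_span n z.
Proof.
elim: n z => [|n IH] z.
  suff [a ->] : exists a, z = hcst q 1 a.
    by rewrite -(incl_cst q (leqnSn 0)); apply: cap_span_incl.
  elim/hecke_ind: z => [a|i|x y [a ->] [b ->]|x y [a ->] [b ->]].
  - by exists a.
  - lia.
  - by exists (a + b); rewrite rmorphD.
  - by exists (a * b); rewrite rmorphM.
rewrite -[z]mul1r; have : cap_span (1 : H n.+2).
  by rewrite -(rmorph1 (incl q (leqnSn n.+1))); apply: cap_span_incl.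
move: 1.
have inclM (x y : H n.+1) : incl q (leqnSn n.+1) (x * y) =
  incl q (leqnSn n.+1) x * incl q (leqnSn n.+1) y by apply: rmorphM.
have spanR (z1 : H n.+2) x : cap_span z1 ->
    cap_span (z1 * incl q (leqnSn n.+1) x).
  elim=> [y|y1 y2|z2 w _ Hz _ Hw].
  - by rewrite -inclM; apply: cap_span_incl.
  - by rewrite -!mulrA -inclM mulrA; apply: cap_span_mid.
  - by rewrite mulrDl; apply: cap_span_add.
have spanL (z1 : H n.+2) x : cap_span z1 ->
    cap_span (incl q (leqnSn n.+1) x * z1).
  elim=> [y|y1 y2|z2 w _ Hz _ Hw].
  - by rewrite -inclM; apply: cap_span_incl.
  - by rewrite !mulrA -inclM; apply: cap_span_mid.
  - by rewrite mulrDr; apply: cap_span_add.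
have spant x : cap_span (t n.+2 n.+1 * incl q (leqnSn n.+1) x).
  have := cap_span_mid 1 x; rewrite rmorph1 mul1r //.
have tt : cap_span (t n.+2 n.+1 * t n.+2 n.+1).
  rewrite ht_quad; last lia.
  apply: cap_span_add; rewrite -(incl_cst q (leqnSn n.+1)).
    exact: cap_span_incl.
  by apply: (spanL); rewrite -[t _ _]mulr1 -(rmorph1 (incl q (leqnSn n.+1))).
have inc2 (x : H n) : incl q (leqnSn n.+1) (incl q (leqnSn n) x)
    = incl q (leqS2 n) x by apply: incl_comp.
have key y : cap_span (t n.+2 n.+1 * incl q (leqnSn n.+1) y * t n.+2 n.+1).
  elim: (IH y) => [x|x1 x2|y1 y2 _ H1 _ H2].
  - by rewrite inc2 t_incl_comm -mulrA -inc2; apply: (spanL).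
  - rewrite !rmorphM !inc2; case: (posnP n) => [n0|n0].
      have -> : t n.+1 n = 0 by rewrite /ht insubF // n0.
      rewrite rmorph0 mulr0 mul0r mulr0 mul0r.
      by rewrite -(rmorph0 (incl q (leqnSn n.+1))); apply: cap_span_incl.
    rewrite incl_t; last lia.
    rewrite !mulrA t_incl_comm -!mulrA -t_incl_comm.
    rewrite -inc2; apply: (spanL); rewrite !mulrA -[_ * incl _ _ _]/(_ * _).
    rewrite -inc2; apply: (spanR).
    rewrite -mulrA -ht_braid; try lia.
    have <- : incl q (leqnSn n.+1) (t n.+1 n) = t n.+2 n by rewrite incl_t //; lia.
    exact: (spanL _ _ (spant _)).
  - by rewrite rmorphD mulrDr mulrDl; apply: cap_span_add.
have spanT z1 : cap_span z1 -> cap_span (z1 * t n.+2 n.+1).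
  elim=> [x|x y|z2 w _ Hz _ Hw].
  - apply: (spanL); rewrite -[t _ _]mulr1 -(rmorph1 (incl q (leqnSn n.+1))).
    exact: spant.
  - rewrite -!mulrA; apply: (spanL); rewrite mulrA; exact: key.
  - by rewrite mulrDl; apply: cap_span_add.
elim/hecke_ind: z => [a|i hi|x y Hx Hy|x y Hx Hy] z1 hz.
- by rewrite -(incl_cst q (leqnSn n.+1)); apply: (spanR).
- have [->|ne] := eqVneq i n.+1; first exact: spanT.
  by rewrite -(incl_t q (leqnSn n.+1)); [apply: (spanR) | lia].
- by rewrite mulrDr; apply: cap_span_add; [apply: Hx | apply: Hy].
- by rewrite mulrA; apply/Hy/Hx.
Qed.

(* LCap is the unique bimodule map with these two properties. *)
Definition LCap n : bimap (B_mp n) (B_nil n) := sval (cid (LCap_exists n)).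

Lemma LCap_incl n z : LCap n (incl q (leqnSn n) z) = z.
Proof. exact: (svalP (cid (LCap_exists n))).1. Qed.
Lemma LCap_t n : (0 < n)%N -> LCap n (t n.+1 n) = 0.
Proof. exact: (svalP (cid (LCap_exists n))).2. Qed.

Lemma LCap_unique n (f : bimap (B_mp n) (B_nil n)) :
  (forall z, f (incl q (leqnSn n) z) = z) -> ((0 < n)%N -> f (t n.+1 n) = 0) ->
  f =1 LCap n.
Proof.
move=> f1 ft z; elim: (cap_spanP z) => [x|x y|z1 w _ Hz _ Hw].
- by rewrite f1 LCap_incl.
- rewrite -[_ * incl _ _ y]/(ract (lact x (t n.+1 n : B_mp n)) y).
  rewrite !bmapR !bmapL; congr (ract (lact _ _) _).
  case: (posnP n) => [n0|n0]; last by rewrite ft // LCap_t.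
  have -> : t n.+1 n = 0 by rewrite /ht insubF // n0.
  by rewrite !bmap0.
- by rewrite !bmapD Hz Hw.
Qed.

(* X (x) id_+ and id_+ (x) X on B_+++(n), and the maps of B_-++(n), where
   B_+++(n) and B_-++(n) are identified with (n+3)_n and _(n+1)(n+2)_n. *)
Definition X_idp n : bimap (B_ppp n) (B_ppp n) :=
  whisker_r (X n.+1 : bimap (hbim _ _) (hbim _ _))
    (leqnSn n) (leqS3 n) (leqS3 n).
Definition idp_X n : bimap (B_ppp n) (B_ppp n) :=
  whisker_l (leqnn n.+3) (leqnSn n.+2)
    (X n : bimap (hbim _ _) (hbim _ _)) (leqS3 n).
Definition RCup_idp n : bimap (B_p n) (B_mpp n) :=
  whisker_r (RCup n.+1 : bimap (hbim _ _) (hbim _ _))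
    (leqnSn n) (leqnSn n) (leqS2 n).
Definition idm_X n : bimap (B_mpp n) (B_mpp n) :=
  whisker_l (leqnSn n.+1) (leqnn n.+2)
    (X n : bimap (hbim _ _) (hbim _ _)) (leqS2 n).
Definition LCap_idp n : bimap (B_mpp n) (B_p n) :=
  whisker_r (LCap n.+1 : bimap (hbim _ _) (hbim _ _))
    (leqnSn n) (leqS2 n) (leqnSn n).

(* The factors of R and L; B_-++-(n) is identified with
   _n(n+1)_(n-1) (x) _(n-1)(n), so the associativity of the tensor product and
   the isomorphism _n(n+1)_n (x) (n)_(n-1) = _n(n+1)_(n-1) intervene. *)
Definition RCup_idpm n : bimap (B_pm n) (B_mppm n) :=
  match n with
  | 0 => bzero _ _
  | m.+1 =>
    tmap (whisker_r (RCup m.+1 : bimap (hbim _ _) (hbim _ _))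
            (leqnSn m) (leqnSn m) (leqS2 m))
         (bid (hbim (leqnSn m) (leqnn m.+1)))
  end.
Definition idm_X_idm n : bimap (B_mppm n) (B_mppm n) :=
  match n with
  | 0 => bzero _ _
  | m.+1 =>
    tmap (whisker_l (leqnSn m.+1) (leqnn m.+2)
            (X m : bimap (hbim _ _) (hbim _ _)) (leqS2 m))
         (bid (hbim (leqnSn m) (leqnn m.+1)))
  end.
Definition idmp_RCap n : bimap (B_mppm n) (B_mp n) :=
  match n with
  | 0 => bzero _ _
  | m.+1 =>
    tcollapse (leqnSn m.+1) (leqnSn m.+1) (leqnn m.+1) (leqnSn m.+1)
    \b tmap (bid (B_mp m.+1)) (RCap m.+1)
    \b tassoc (B_mp m.+1) (hbim (leqnn m.+1) (leqnSn m))
              (hbim (leqnSn m) (leqnn m.+1))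
    \b tmap (texpand (leqnSn m.+1) (leqnSn m.+1) (leqnSn m) (leqS2 m))
            (bid (hbim (leqnSn m) (leqnn m.+1)))
  end.
Definition idmp_LCup (qV : A) (hq : q * qV = 1) n : bimap (B_mp n) (B_mppm n) :=
  match n with
  | 0 => bzero _ _
  | m.+1 =>
    tmap (tcollapse (leqnSn m.+1) (leqnSn m.+1) (leqnSn m) (leqS2 m))
         (bid (hbim (leqnSn m) (leqnn m.+1)))
    \b tassocV (B_mp m.+1) (hbim (leqnn m.+1) (leqnSn m))
               (hbim (leqnSn m) (leqnn m.+1))
    \b tmap (bid (B_mp m.+1)) (LCup hq m.+1)
    \b texpand (leqnSn m.+1) (leqnSn m.+1) (leqnn m.+1) (leqnSn m.+1)
  end.
Definition LCap_idpm n : bimap (B_mppm n) (B_pm n) :=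
  match n with
  | 0 => bzero _ _
  | m.+1 =>
    tmap (whisker_r (LCap m.+1 : bimap (hbim _ _) (hbim _ _))
            (leqnSn m) (leqS2 m) (leqnSn m))
         (bid (hbim (leqnSn m) (leqnn m.+1)))
  end.

Definition Rmap n : bimap (B_pm n) (B_mp n) :=
  idmp_RCap n \b idm_X_idm n \b RCup_idpm n.
Definition Lmap (qV : A) (hq : q * qV = 1) n : bimap (B_mp n) (B_pm n) :=
  LCap_idpm n \b idm_X_idm n \b idmp_LCup hq n.

End HeckeBimodules.

(* Main.v *)
(* Part 3: R sends x (x) y to x t_n y, and H_(n+1) = H_n + H_n t_n H_n, so
   everything reduces to L(1) = 0 and L(t_n) = q (1 (x) 1).  In
   L(z) = sum_i q^(i-n) LCap(z t_i ... t_n) (x) t_(n-1) ... t_i every term with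
   z = 1 vanishes because LCap(t_n) = 0; for z = t_n and i < n the relation
   t_n (t_i ... t_n) = (t_i ... t_n) t_(n-1) makes the term vanish as well, and
   the term i = n is LCap(t_n^2) (x) 1 = q (1 (x) 1). *)
Require Import Defs.
From mathcomp Require Import all_boot all_order all_algebra.
From mathcomp Require Import zify.

Set Implicit Arguments.
Unset Strict Implicit.
Unset Printing Implicit Defensive.

Import GRing.Theory.
Local Open Scope ring_scope.

Lemma bmap_sum (R S : pzRingType) (M N : bimod R S) (f : bimap M N)
    (I : Type) (r : seq I) (F : I -> M) :
  f (\sum_(i <- r) F i) = \sum_(i <- r) f (F i).
Proof. by elim/big_rec2: _ => [|i u v _ <-]; rewrite ?bmap0 ?bmapD. Qed.

Lemma pure_sumr (R S T : pzRingType) (M : bimod R S) (N : bimod S T)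
    (I : Type) (r : seq I) (x : M) (F : I -> N) :
  pure x (\sum_(i <- r) F i) = \sum_(i <- r) pure x (F i).
Proof. by elim/big_rec2: _ => [|i u v _ <-]; rewrite ?pure0r ?pureDr. Qed.

Section HeckeMaps.
Variables (A : comPzRingType) (q : A).
Local Notation H := (@Defs_hecke__canonical__GRing_PzRing A q).
Local Notation t := (ht q).
Local Notation tup := (tup q).
Local Notation tdown := (tdown q).

(** * Whiskered maps as explicit maps between Hecke algebras *)

Lemma whisker_rE k n n' m l (hk : (k <= n)%N) (hm : (m <= n)%N)
    (hk' : (k <= n')%N) (hm' : (m <= n')%N)
    (f : bimap (hbim q hk hm) (hbim q hk' hm'))
    (hl : (l <= m)%N) (hln : (l <= n)%N) (hln' : (l <= n')%N) (z : H n) :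
  whisker_r f hl hln hln' z = f z.
Proof.
by rewrite /whisker_r !bcompE texpandE tmap_pure tcollapse_pure rmorph1 mulr1.
Qed.

(** The standard isomorphism sends [z] to [z (x) 1], so [f] only meets [1]. Hence [id (x) X] becomes
    right multiplication by a single generator. *)
Lemma whisker_lE k n m l (hk : (k <= n)%N) (hm : (m <= n)%N)
    (hl : (l <= m)%N) (f : bimap (hbim q (leqnn m) hl) (hbim q (leqnn m) hl))
    (hln : (l <= n)%N) (z : H n) :
  whisker_l hk hm f hln z = z * incl q hm (f (1 : H m)).
Proof. by rewrite /whisker_l !bcompE texpandE tmap_pure tcollapse_pure. Qed.

Lemma XE n (z : H n.+2) : X q n z = z * t n.+2 n.+1. Proof. by []. Qed.

Lemma X_idpE n (z : H n.+3) : X_idp q n z = z * t n.+3 n.+2.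
Proof. by rewrite /X_idp whisker_rE. Qed.

Lemma idp_XE n (z : H n.+3) : idp_X q n z = z * t n.+3 n.+1.
Proof. by rewrite /idp_X whisker_lE XE mul1r incl_t //; lia. Qed.

Lemma idm_XE n (z : H n.+2) : idm_X q n z = z * t n.+2 n.+1.
Proof. by rewrite /idm_X whisker_lE XE mul1r incl_id. Qed.

Lemma RCup_idpE n (z : H n.+1) : RCup_idp q n z = incl q (leqnSn n.+1) z.
Proof. by rewrite /RCup_idp whisker_rE. Qed.

Lemma LCap_idpE n (z : H n.+2) : LCap_idp q n z = LCap q n.+1 z.
Proof. by rewrite /LCap_idp whisker_rE. Qed.

Lemma LCap_mull n (x : H n) (z : H n.+1) :
  LCap q n (incl q (leqnSn n) x * z) = x * LCap q n z.
Proof.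
by rewrite -[LHS]/(LCap q n (lact x (z : B_mp q n))) bmapL lact_hbim incl_id.
Qed.

Lemma LCap_mulr n (x : H n) (z : H n.+1) :
  LCap q n (z * incl q (leqnSn n) x) = LCap q n z * x.
Proof.
by rewrite -[LHS]/(LCap q n (ract (z : B_mp q n) x)) bmapR ract_hbim incl_id.
Qed.

Definition pure_mppm m (x : H m.+2) (y : H m.+1) : B_mppm q m.+1 :=
  @pure _ _ _ (hbim q (leqnSn m.+1) (leqS2 m))
    (hbim q (leqnSn m) (leqnn m.+1)) x y.

Lemma RCup_idpm_pure m (x y : H m.+1) :
  RCup_idpm q m.+1 (pure_pm x y) = pure_mppm (incl q (leqnSn m.+1) x) y.
Proof. by rewrite [LHS]tmap_pure whisker_rE. Qed.

Lemma idm_X_idm_pure m (x : H m.+2) (y : H m.+1) :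
  idm_X_idm q m.+1 (pure_mppm x y) = pure_mppm (x * t m.+2 m.+1) y.
Proof. by rewrite [LHS]tmap_pure whisker_lE XE mul1r incl_id. Qed.

Lemma idmp_RCap_pure m (x : H m.+2) (y : H m.+1) :
  idmp_RCap q m.+1 (pure_mppm x y) = x * incl q (leqnSn m.+1) y.
Proof.
(* The tensor passes through [(x (x) 1) (x) y], [x (x) (1 (x) y)] and [x (x) 1 y] before being
   multiplied out. *)
rewrite /idmp_RCap !bcompE tmap_pure texpandE tassoc_pure tmap_pure RCap_pure.
by rewrite tcollapse_pure mul1r.
Qed.

Lemma LCap_idpm_pure m (x : H m.+2) (y : H m.+1) :
  LCap_idpm q m.+1 (pure_mppm x y) = pure_pm (LCap q m.+1 x) y.
Proof. by rewrite [LHS]tmap_pure whisker_rE. Qed.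

(** Associativity lets [z] absorb the left leg of each term of [casimir], together with its power of
    [qV]. *)
Lemma idmp_LCupE (qV : A) (hq : q * qV = 1) m (z : H m.+2) :
  idmp_LCup hq m.+1 z = \sum_(1 <= i < m.+2)
    pure_mppm (z * incl q (leqnSn m.+1)
                 (hcst q _ (qV ^+ (m.+1 - i)) * tup m.+1 i))
      (tdown m.+1 i).
Proof.
rewrite /idmp_LCup !bcompE texpandE tmap_pure LCupE lact1 /casimir.
rewrite pure_sumr !bmap_sum; apply: eq_bigr => i _.
by rewrite /cas_term lact_pm tassocV_pure tmap_pure tcollapse_pure.
Qed.

(** * Formulas for [R] and [L], and the values of [L] on [H_n] and on [t_n] *)

Lemma Rmap_pure m (x y : H m.+1) :
  Rmap q m.+1 (pure_pm x y) =
  incl q (leqnSn m.+1) x * t m.+2 m.+1 * incl q (leqnSn m.+1) y.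
Proof.
by rewrite /Rmap 2!bcompE RCup_idpm_pure idm_X_idm_pure idmp_RCap_pure.
Qed.

Lemma LmapE (qV : A) (hq : q * qV = 1) m (z : H m.+2) :
  Lmap hq m.+1 z = \sum_(1 <= i < m.+2)
    pure_pm (LCap q m.+1 (z * incl q (leqnSn m.+1)
        (hcst q _ (qV ^+ (m.+1 - i)) * tup m.+1 i) * t m.+2 m.+1))
      (tdown m.+1 i).
Proof.
rewrite /Lmap 2!bcompE idmp_LCupE !bmap_sum; apply: eq_bigr => i _.
by rewrite idm_X_idm_pure LCap_idpm_pure.
Qed.

(** In every term [x] and the ascending word lie in [H m.+1], so they leave [LCap] and only the top
    generator remains inside. *)
Lemma Lmap_incl (qV : A) (hq : q * qV = 1) m (x : H m.+1) :
  Lmap hq m.+1 (incl q (leqnSn m.+1) x) = 0.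
Proof.
rewrite LmapE big1 // => i _.
by rewrite -rmorphM LCap_mull LCap_t // mulr0 [pure_pm _ _]pure0l.
Qed.

(** Read one algebra up, the word stops short of the last letter of [tup m.+1 i] when [i <= m]; this
    lets that letter be split off. *)
Lemma incl_tup m i : (0 < i)%N ->
  incl q (leqnSn m) (tup m i) = \prod_(i <= j < m) t m.+1 j.
Proof.
move=> i0; rewrite /Defs.tup rmorph_prod big_nat_cond [RHS]big_nat_cond.
by apply: eq_bigr => j /andP[/andP[ij jm] _]; rewrite incl_t //; lia.
Qed.

(** The word followed by the top generator is [tup m.+2 i]. Sliding [t_(m+1)] through it lowers the
    index by one, which requires the letter [t_m], hence [i <= m]. *)
Lemma t_incl_tup m i : (0 < i <= m)%N ->
  t m.+2 m.+1 * incl q (leqnSn m.+1) (tup m.+1 i) * t m.+2 m.+1 =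
  incl q (leqnSn m.+1) (tup m.+1 i) * t m.+2 m.+1 * t m.+2 m.
Proof.
move=> /andP[i0 im].
have E : tup m.+2 i = incl q (leqnSn m.+1) (tup m.+1 i) * t m.+2 m.+1.
  by rewrite incl_tup // /Defs.tup big_nat_recr //=; lia.
by rewrite -mulrA -E tup_comm_gt //; lia.
Qed.

Lemma Lmap_t (qV : A) (hq : q * qV = 1) m :
  Lmap hq m.+1 (t m.+2 m.+1) = pure_pm (hcst q _ q) 1.
Proof.
rewrite LmapE big_nat_recr // big_nat_cond big1 => [|i].
  (* The term [i = m.+1]: both words are empty and the exponent of [qV] is 0, so the quadratic
     relation leaves [q]. *)
  rewrite subnn tup_geq // tdown_geq // mulr1 expr0 !rmorph1 mulr1.
  rewrite ht_quad; last lia.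
  rewrite bmapD -!(incl_cst q (leqnSn m.+1)) LCap_incl LCap_mull LCap_t //.
by rewrite [LHS]add0r mulr0 addr0.
(* The terms [i <= m]: here [m > 0], so [t_m] comes from [H m.+1]. After the slide the top generator
   occurs once, between elements of [H m.+1], and [LCap] kills it. *)
rewrite andbT => hi; rewrite rmorphM incl_cst mulrA -hcst_comm -!mulrA.
rewrite [t _ _ * _]mulrA t_incl_tup; last lia.
rewrite -(incl_cst q (leqnSn m.+1)) -(@incl_t _ q _ _ (leqnSn m.+1) m); last lia.
rewrite -mulrA !LCap_mull LCap_mulr LCap_t // mul0r !mulr0.
by rewrite [pure_pm _ _]pure0l.
Qed.

(** * Verification of the relations *)

Lemma bscaleE k n l (hk : (k <= n)%N) (hl : (l <= n)%N) a (z : H n) :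
  bscale a (z : hbim q hk hl) = hcst q n a * z.
Proof. by rewrite /bscale lact_hbim incl_cst. Qed.

Lemma X_quad n (z : H n.+2) :
  (X q n \b X q n) z =
  bscale q (z : B_pp q n) + bscale (q - 1) (X q n z).
Proof.
rewrite bcompE !XE !bscaleE -mulrA ht_quad; last lia.
by rewrite mulrDr (mulrA z) -!hcst_comm -(mulrA _ z).
Qed.

(** The two maps are right multiplications by the adjacent generators [t_(n+2)] and [t_(n+1)] of
    [H n.+3]. *)
Lemma X_braid n (z : H n.+3) :
  (X_idp q n \b idp_X q n \b X_idp q n) z =
  (idp_X q n \b X_idp q n \b idp_X q n) z.
Proof.
rewrite -[LHS]/(X_idp q n (idp_X q n (X_idp q n z))).
rewrite -[RHS]/(idp_X q n (X_idp q n (idp_X q n z))).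
by rewrite !(X_idpE, idp_XE) -!mulrA ht_braid //; lia.
Qed.

Lemma Lmap_Rmap (qV : A) (hq : q * qV = 1) n (z : B_pm q n) :
  (Lmap hq n \b Rmap q n) z = bscale q z.
Proof.
(* [B_pm q 0] has carrier ['I_1], so both sides are zero. *)
case: n z => [z|m z]; first by rewrite [LHS]ord1 [RHS]ord1.
rewrite bcompE; elim/tens_ind: z => [|x y|z w Hz Hw].
- by rewrite !bmap0 /bscale lact0.
- rewrite -[pure x y]/(pure_pm x y) Rmap_pure.
  (* As a two-sided multiple of the top generator, the product is sent by [L] to
     [x q (1 (x) 1) y]. *)
  rewrite -[_ * incl _ _ y]/(ract (lact x (t m.+2 m.+1 : B_mp q m.+1)) y).
  rewrite bmapR bmapL Lmap_t lact_pm ract_pm mul1r /bscale lact_pm.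
  by rewrite hcst_comm.
- by rewrite !bmapD Hz Hw /bscale lactDr.
Qed.

Lemma Rmap_Lmap (qV : A) (hq : q * qV = 1) n (z : B_mp q n) :
  (Rmap q n \b Lmap hq n) z =
  bscale q z - bscale q ((RCup q n \b LCap q n) z).
Proof.
rewrite -[LHS]/(Rmap q n (Lmap hq n z)).
rewrite -[(_ \b _) z]/(RCup q n (LCap q n z)).
elim: (cap_spanP z) => [x|x y|z1 w _ Hz _ Hw].
(* On [H_n] the composite of [LCap] and [RCup] is the identity, so the right side cancels, while [L]
   vanishes. *)
- rewrite LCap_incl subrr; case: n {z} x => [x|m x]; first by [].
  by rewrite Lmap_incl bmap0.
- case: n {z} x y => [x y|m x y].
    (* For label 0 there is no generator: [t 1 0] is the dummy value 0. *)
    have -> : t 1 0 = 0 by rewrite /ht insubF.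
    by rewrite mulr0 mul0r !bmap0 /bscale !lact0 subrr.
  (* On [H_n t_n H_n] the correction term vanishes, and [R] brings [q (x (x) y)] back to
     [q x t_n y]. *)
  rewrite LCap_mulr LCap_mull LCap_t // mulr0 mul0r bmap0 {2}/bscale lact0 subr0.
  rewrite -[_ * incl _ _ y in LHS]/(ract (lact x (t m.+2 m.+1 : B_mp q m.+1)) y).
  rewrite (bmapR (Lmap hq _)) (bmapL (Lmap hq _)) Lmap_t lact_pm ract_pm mul1r.
  rewrite Rmap_pure bscaleE.
  by rewrite -hcst_comm rmorphM incl_cst -!mulrA.
- by rewrite (bmapD (Lmap hq n)) (bmapD (LCap q n)) !bmapD Hz Hw /bscale !lactDr
    opprD addrACA.
Qed.

Lemma LCap_RCup n (z : H n) : (LCap q n \b RCup q n) z = z.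
Proof. exact: LCap_incl. Qed.

Lemma LCap_X_RCup n (z : H n.+1) :
  (LCap_idp q n \b idm_X q n \b RCup_idp q n) z = 0.
Proof.
by rewrite 2!bcompE RCup_idpE idm_XE LCap_idpE LCap_mull LCap_t // mulr0.
Qed.

End HeckeMaps.

Theorem proposition5p7 (k A : comPzRingType) (f : {rmorphism k -> A})
    (q qV : A) (hq : q * qV = 1) (hA : is_laurent f q qV \/ bijective f)
    (n : nat) :
  [/\ (* 1 *)
      forall z : B_pp q n,
        (X q n \b X q n) z = bscale q z + bscale (q - 1) (X q n z),
      (* 2 *)
      forall z : B_ppp q n,
        (X_idp q n \b idp_X q n \b X_idp q n) z =
        (idp_X q n \b X_idp q n \b idp_X q n) z,
      (* 3 *)
      (forall z : B_mp q n,
        (Rmap q n \b Lmap hq n) z =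
        bscale q z - bscale q ((RCup q n \b LCap q n) z)) /\
      (forall z : B_pm q n, (Lmap hq n \b Rmap q n) z = bscale q z) &
      (* 4 *)
      (forall z : B_nil q n, (LCap q n \b RCup q n) z = z) /\
      (forall z : B_p q n,
        (LCap_idp q n \b idm_X q n \b RCup_idp q n) z = 0)].
Proof.
split.
- exact: X_quad.
- exact: X_braid.
- by split; [apply: Rmap_Lmap | apply: Lmap_Rmap].
- by split; [apply: LCap_RCup | apply: LCap_X_RCup].
Qed.
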